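(* Let $Y=(Y_t)_{t\in[0,\infty)}$ be a stable process with stability parameter $\alpha$ and positivity parameter $\rho\in(0,1)$, and let $\overline{Y}_1=\sup_{s\in[0,1]}Y_s$. Let $(B,U,V,S,\overline{Y}_1)$ be a random vector with independent components, where $U$ and $V$ are uniform on $(0,1)$, $B$ is Bernoulli with $\mathbb{P}(B=1)=1-\rho$, $\mathbb{P}(B=0)=\rho$, and $S$ has the law of $Y_1$ conditioned on being positive. Put $\Lambda=1+B\,(V^{1/\rho}-1)$. Then the following equality in law holds: $$\overline{Y}_1\overset{d}{=}\Lambda^{1/\alpha}\left(U^{1/\alpha}\,\overline{Y}_1+(1-U)^{1/\alpha}S\right).$$ Furthermore, the law of $\overline{Y}_1$ is the unique solution of this equation; that is, if $\mu$ is a probability law on $\mathbb{R}$ such that $\zeta\overset{d}{=}\Lambda^{1/\alpha}(U^{1/\alpha}\zeta+(1-U)^{1/\alpha}S)$ whenever $\zeta\sim\mu$ is independent of $(B,U,V,S)$, then $\mu$ is the law of $\overline{Y}_1$.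
   Context: A (strictly) stable process with stability parameter $\alpha\in(0,2]$ is a real-valued Lévy process $Y=(Y_t)_{t\in[0,\infty)}$ with $Y_0=0$ (càdlàg paths) such that for every constant $c\ge 0$ the processes $(Y_{ct})_{t\ge0}$ and $(c^{1/\alpha}Y_t)_{t\ge0}$ have the same law. Its positivity parameter is $\rho=\mathbb{P}(Y_1>0)$. Up to a scaling constant, the law of $Y_1$ is determined by $(\alpha,\rho)$ via $$\mathbb{E}\,e^{itY_1}=\exp\left(-|t|^{\alpha}e^{-i\frac{\pi\alpha}{2}\theta\,\mathrm{sgn}(t)}\right),\quad t\in\mathbb{R},\qquad \theta=2\rho-1,$$ where $\mathrm{sgn}(t)=1$ if $t\ge 0$ and $-1$ if $t<0$; this normalisation is used. If $\alpha>1$ then $\rho$ must lie in $[1-\frac1\alpha,\frac1\alpha]$. The cases $\rho\in\{0,1\}$ (monotone paths) are excluded throughout. *)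

(* Defs.v *)
From HB Require Import structures.
From mathcomp Require Export all_boot all_order all_algebra.
From mathcomp Require Export all_classical all_reals all_analysis.
From mathcomp Require Export complex.
Set Implicit Arguments.
Unset Strict Implicit.
Unset Printing Implicit Defensive.
Import Order.TTheory GRing.Theory Num.Theory.
Import numFieldNormedType.Exports.
Local Open Scope classical_set_scope.
Local Open Scope ring_scope.

(* Equality of laws is tested on measurable sets only: [pushforward P X] also
   takes (irrelevant) values on non-measurable sets. *)
Definition eq_law d (E : measurableType d) (R : realType)
    (mu nu : set E -> \bar R) : Prop :=
  forall A, measurable A -> mu A = nu A.

(* Subfamilies are covered by taking [A i = setT] for the missing indices. *)
Definition independent d (T : measurableType d) (R : realType)
    (P : probability T R) (n : nat) (X : 'I_n -> T -> R) : Prop :=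
  forall A : 'I_n -> set R, (forall i, measurable (A i)) ->
    P (\bigcap_(i in [set: 'I_n]) (X i @^-1` A i)) =
    (\prod_(i < n) P (X i @^-1` A i))%E.

Definition cond_law d (T : measurableType d) (R : realType)
    (P : probability T R) (X : T -> R) (E : set T) (A : set R) : \bar R :=
  (P (X @^-1` A `&` E) / P E)%E.

(* The product sigma-algebra on paths indexed by [0, +oo[; paths are total
   functions [R -> R], but only coordinates t >= 0 generate, so that values at
   negative times are irrelevant. *)
Definition path_measurable (R : realType) : set (set (R -> R)) :=
  <<s [set C | exists (t : R) (A : set R),
         [/\ 0 <= t, measurable A & C = [set y | A (y t)]]] >>.

Definition eq_path_law d (T : measurableType d) (R : realType)
    (P : probability T R) (X Z : R -> T -> R) : Prop :=
  forall C, @path_measurable R C ->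
    P [set w | C (X ^~ w)] = P [set w | C (Z ^~ w)].

Definition cadlag (R : realType) (f : R -> R) : Prop :=
  (forall t, 0 <= t -> f x @[x --> t^'+] --> f t) /\
  (forall t, 0 < t -> cvg (f x @[x --> t^'-])).

Record levy_process d (T : measurableType d) (R : realType)
    (P : probability T R) (Y : R -> {RV P >-> R}) : Prop := {
  levy_start : forall w, Y 0 w = 0 ;
  levy_cadlag : forall w, cadlag (Y ^~ w) ;
  levy_indep : forall (n : nat) (t : nat -> R),
    0 <= t 0%N -> (forall i, t i <= t i.+1) ->
    independent P (fun (i : 'I_n) w => Y (t i.+1) w - Y (t i) w) ;
  levy_stationary : forall s t, 0 <= s -> s <= t ->
    eq_law (pushforward P (fun w => Y t w - Y s w)) (pushforward P (Y (t - s)))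
}.

Definition cexp (R : realType) (z : R[i]) : R[i] :=
  Complex (expR (complex.Re z) * cos (complex.Im z))
          (expR (complex.Re z) * sin (complex.Im z)).

(* E[exp(itX)] *)
Definition char_fun d (T : measurableType d) (R : realType)
    (P : probability T R) (X : T -> R) (t : R) : R[i] :=
  Complex (\int[P]_w complex.Re (cexp (Complex 0 (t * X w))))
          (\int[P]_w complex.Im (cexp (Complex 0 (t * X w)))).

Definition stable_char_fun (R : realType) (alpha rho t : R) : R[i] :=
  let theta := 2 * rho - 1 in
  let sgn := if 0 <= t then 1 else -1 in
  cexp (- (Complex (`|t| `^ alpha) 0
           * cexp (Complex 0 (- (pi * alpha / 2 * theta * sgn))))).

Record stable_process d (T : measurableType d) (R : realType)
    (P : probability T R) (alpha rho : R) (Y : R -> {RV P >-> R}) : Prop := {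
  stable_levy : levy_process Y ;
  stable_scaling : forall c, 0 <= c ->
    eq_path_law P (fun t w => Y (c * t) w) (fun t w => c `^ alpha^-1 * Y t w) ;
  stable_positivity : P [set w | 0 < Y 1 w] = rho%:E ;
  stable_normalised : forall t,
    char_fun P (Y 1) t = stable_char_fun alpha rho t
}.

(* A genuine supremum, since cadlag paths are bounded on [0, 1]. *)
Definition sup01 d (T : measurableType d) (R : realType)
    (P : probability T R) (Y : R -> {RV P >-> R}) (w : T) : R :=
  sup [set Y s w | s in `[0, 1]].

Definition perpetuity_map (R : realType) (alpha rho b u v s z : R) : R :=
  let Lambda := 1 + b * (v `^ rho^-1 - 1) in
  Lambda `^ alpha^-1 * (u `^ alpha^-1 * z + (1 - u) `^ alpha^-1 * s).

(* [zeta] is equal in law to the right-hand side whenever [zeta] has law [mu]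
   and B, U, V, S, [zeta] are independent, with S of law [sigma]; these
   variables may live on any probability space. *)
Definition solves_perpetuity (R : realType) (alpha rho : R)
    (sigma mu : set R -> \bar R) : Prop :=
  forall (d : measure_display) (T : measurableType d) (Q : probability T R)
    (B U V S zeta : {RV Q >-> R}),
  independent Q (tnth [tuple (B : T -> R); (U : T -> R); (V : T -> R);
                             (S : T -> R); (zeta : T -> R)]) ->
  Q [set w | B w = 1] = (1 - rho)%:E ->
  Q [set w | B w = 0] = rho%:E ->
  eq_law (pushforward Q U) (uniform_prob (@ltr01 R)) ->
  eq_law (pushforward Q V) (uniform_prob (@ltr01 R)) ->
  eq_law (pushforward Q S) sigma ->
  eq_law (pushforward Q zeta) mu ->
  eq_law (pushforward Q zeta)
    (pushforward Q (fun w =>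
       perpetuity_map alpha rho (B w) (U w) (V w) (S w) (zeta w))).

(* Main.v *)
From HB Require Import structures.
Require Import Defs.
From mathcomp Require Import all_boot all_order all_algebra.
From mathcomp Require Import all_classical all_reals all_analysis.
From mathcomp Require Import measurable_realfun.
From mathcomp Require Import ring lra zify.
Set Implicit Arguments.
Unset Strict Implicit.
Unset Printing Implicit Defensive.
Import Order.TTheory GRing.Theory Num.Theory.
Import numFieldNormedType.Exports.
Local Open Scope classical_set_scope.
Local Open Scope ring_scope.

(* Let M_n = max(0, S_1, ..., S_n) for a random walk S.  By the Lindley recursion,
   M_n is distributed as (X_1 + M_(n-1))^+, and since x |-> x^+ satisfies a
   Rota-Baxter identity, a telescoping sum yields Spitzer's identity in the form
     n E f(M_n) = sum_(j < n) E f(M_j + S'_(n-j)^+)   (S' an independent copy).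
   Applied to Y sampled on a grid of mesh 1/n and rescaled by self-similarity,
   this becomes, as n tends to infinity,
     Ybar =d U^(1/alpha) Ybar + (1 - U)^(1/alpha) Y_1^+.
   The factor Y_1^+ vanishes with probability 1 - rho.  The law of V^(1/rho)
   satisfies V^(1/rho) =d U with probability rho and U V^(1/rho) otherwise, which
   absorbs the vanishing steps into Lambda.  Uniqueness is a contraction argument:
   z |-> Lambda^(1/alpha) (U^(1/alpha) z + ...) maps L-Lipschitz test functions to
   cL-Lipschitz ones on average, with c = E U^(1/alpha) < 1. *)

(** * Independence and iterated integrals *)

(** Two obstacles shape the argument. Integrals take values in [\bar R], where subtraction is
    unsafe, and the variables are heavy-tailed, so that neither the supremum nor S need have a mean.
    Hence Spitzer's identity is obtained for all nonnegative test functions by adding equal terms to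
    both sides, and uniqueness uses [0, 1]-valued test functions, whose increments are bounded by
    min(1, L c^n |x - y|); no moment of mu enters.

    Absorbing the vanishing steps is an algebraic cancellation. Write m(f) for E f(Ybar), A for a
    step with increment S, D for scaling by U^(1/alpha), K for scaling by V^(1/(rho alpha)). The
    limit equation is m(g) = rho m(A g) + (1 - rho) m(D g), and the law of V^(1/rho) gives K f = rho
    D f + (1 - rho) D K f. With g = rho f + (1 - rho) K f one gets D g = K f; the term (1 - rho) m(K
    f) then stands on both sides, and removing it leaves m(f) = m(A g), where A g is the perpetuity
    step. The removal requires a finite term, hence bounded f.

    A solution mu is known only through random vectors, so uniqueness first constructs a space
    carrying one. *)

Lemma eq_law_integral d d1 d2 (R : realType) (E : measurableType d)
    (T1 : measurableType d1) (T2 : measurableType d2)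
    (P1 : {measure set T1 -> \bar R}) (P2 : {measure set T2 -> \bar R})
    (X1 : T1 -> E) (X2 : T2 -> E) (f : E -> \bar R) :
  measurable_fun setT X1 -> measurable_fun setT X2 ->
  (forall A, measurable A -> P1 (X1 @^-1` A) = P2 (X2 @^-1` A)) ->
  measurable_fun setT f -> (forall x, 0 <= f x)%E ->
  (\int[P1]_w f (X1 w) = \int[P2]_w f (X2 w))%E.
Proof.
move=> mX1 mX2 X12 mf f0.
have := @ge0_integral_pushforward _ _ _ _ _ _ mX1 P1 setT f measurableT mf (fun
    y _ => f0 y).
rewrite preimage_setT => <-.
have := @ge0_integral_pushforward _ _ _ _ _ _ mX2 P2 setT f measurableT mf (fun
    y _ => f0 y).
rewrite preimage_setT => <-.
by apply: eq_measure_integral => A mA _; exact: X12.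
Qed.

(** Rectangles are stable under intersection, generate the product sigma-algebra and include the
    whole space, whose mass is finite. *)
Lemma measure_prod_ext d1 d2 (T1 : measurableType d1) (T2 : measurableType d2)
    (R : realType) (m m' : {measure set (T1 * T2) -> \bar R}) :
  (m setT < +oo)%E ->
  (forall A B, measurable A -> measurable B -> m (A `*` B) = m' (A `*` B)) ->
  forall C, measurable C -> m C = m' C.
Proof.
move=> moo mm' C mC.
pose G : set (set (T1 * T2)) :=
  [set A | exists2 B, measurable B & exists2 C, measurable C & A = B `*` C].
apply: (measure_unique G (fun=> setT)) => //.
- rewrite measurable_prod_measurableType //; congr (<<s _ >>).
  apply/seteqP; split=> [_ [A mA [B mB <-]]|_ [A mA [B mB ->]]].
    by exists A => //; exists B.
  by exists A => //; exists B.
- move=> _ _ [A1 mA1 [A2 mA2 ->]] [B1 mB1 [B2 mB2 ->]].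
  rewrite -setXI; exists (A1 `&` B1); first exact: measurableI.
  by exists (A2 `&` B2) => //; exact: measurableI.
- by move=> _; exists setT => //; exists setT => //; rewrite setXTT.
- by rewrite bigcup_const//; exists 0%N.
- by move=> _ [A mA [B mB ->]]; exact: mm'.
Qed.

Section independence.
Local Open Scope ereal_scope.
Context d (T : measurableType d) (R : realType) (P : probability T R).
Context (n : nat) (X : 'I_n -> T -> R).

(* Joint independence of [Z, X k, ..., X n.-1]: the first [k] variables are
   discarded by taking [B i = setT]. *)
Definition indep_tail (k : nat) d' (E : measurableType d') (Z : T -> E) :=
  forall (A : set E) (B : 'I_n -> set R), measurable A ->
    (forall i, measurable (B i)) -> (forall i : 'I_n, (i < k)%N -> B i = setT) ->
    P (Z @^-1` A `&` \bigcap_(i in [set: 'I_n]) (X i @^-1` B i)) =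
    P (Z @^-1` A) * \prod_(i < n) P (X i @^-1` B i).

Lemma indep_tail_cst d' (E : measurableType d') (c : E) :
  independent P X -> indep_tail 0 (cst c).
Proof.
move=> iX A B mA mB _.
rewrite preimage_cst; case: ifPn => _.
  by rewrite setTI probability_setT mul1e iX.
by rewrite set0I measure0 mul0e.
Qed.

Lemma indep_tail_comp k d1 d2 (E1 : measurableType d1) (E2 : measurableType d2)
    (Z : T -> E1) (g : E1 -> E2) :
  measurable_fun setT g -> indep_tail k Z -> indep_tail k (g \o Z).
Proof.
move=> mg iZ A B mA mB BT.
have -> : (g \o Z) @^-1` A = Z @^-1` (g @^-1` A) by [].
by apply: iZ => //; rewrite -[_ @^-1` _]setTI; exact: mg.
Qed.

Lemma indep_tail_pair d' (E : measurableType d') (Z : T -> E) (k : 'I_n)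
    (A : set E) (B : set R) :
  indep_tail k Z -> measurable A -> measurable B ->
  P (Z @^-1` A `&` X k @^-1` B) = P (Z @^-1` A) * P (X k @^-1` B).
Proof.
move=> iZ mA mB.
pose C i := if i == k then B else setT.
have mC i : measurable (C i) by rewrite /C; case: ifP.
have CT (i : 'I_n) : (i < k)%N -> C i = setT.
  by rewrite /C; case: eqP => // ->; rewrite ltnn.
have := iZ A C mA mC CT.
rewrite (bigD1 k)//= [C k]/C eqxx big1 ?mule1; last first.
  by move=> i /negbTE ik; rewrite /C ik preimage_setT probability_setT.
move=> <-; congr (P (_ `&` _)).
apply/seteqP; split => [w Bw i _|w Bw].
  by rewrite /C/=; case: eqP => [->|].
by have /= := Bw k I; rewrite /C eqxx.
Qed.

(** Reversal serves twice: the Lindley recursion consumes the increments of the walk from the last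
    one backwards, and the perpetuity integral keeps [zeta], the last of its five variables, until
    the end. *)
Lemma independent_rev : independent P X -> independent P (fun i => X (rev_ord i)).
Proof.
move=> iX A mA.
have := iX (fun i => A (rev_ord i)) (fun i => mA (rev_ord i)).
rewrite (reindex_inj rev_ord_inj)/= => H.
transitivity (\prod_(j < n) P (X (rev_ord j) @^-1` A (rev_ord (rev_ord j)))).
  rewrite -H; congr (P _); apply/seteqP; split => w h i _.
    by have := h (rev_ord i) I; rewrite rev_ordK.
  by have := h (rev_ord i) I; rewrite rev_ordK.
by apply: eq_bigr => i _; rewrite rev_ordK.
Qed.

Section step.
Context d' (E : measurableType d') (Z : T -> E) (k : 'I_n).
Hypotheses (mZ : measurable_fun setT Z) (mX : forall i, measurable_fun setT (X i)).
Hypothesis iZ : indep_tail k Z.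

Let mF : isMeasurableFun _ _ _ _ (Z : T -> E) := isMeasurableFun.Build _ _ _ _ _ mZ.
Let Z' : {mfun T >-> E} := HB.pack Z mF.
Let mG : isMeasurableFun _ _ _ _ (X k : T -> R) := isMeasurableFun.Build _ _ _
    _ _ (mX k).
Let Xk : {mfun T >-> R} := HB.pack (X k) mG.
Let mZX : measurable_fun setT (fun w => (Z w, X k w)).
Proof. exact/measurable_fun_pair. Qed.
Let mH : isMeasurableFun _ _ _ _ (fun w => (Z w, X k w)) :=
  isMeasurableFun.Build _ _ _ _ _ mZX.
Let ZX : {mfun T >-> (E * R)%type} := HB.pack (fun w => (Z w, X k w)) mH.

(** With the events on the later variables fixed, both sides are finite measures in [A], so
    rectangles suffice; on a rectangle the constraint on [X k] moves into slot [k] of the hypothesis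
    on [Z]. *)
Lemma indep_tailS : indep_tail k.+1 (fun w => (Z w, X k w)).
Proof.
move=> A B mA mB BT.
set D := \bigcap_(i in _) _.
have mD : measurable D.
  apply: fin_bigcap_measurable => // i _.
  by rewrite -[_ @^-1` _]setTI; exact: mX.
set c := \prod_(i < n) _.
have DE F : measurable F -> P (Z @^-1` F `&` D) = P (Z @^-1` F) * c.
  by move=> mF'; rewrite iZ// => i ik; rewrite BT// (ltn_trans ik).
(* [mscale] takes a nonnegative real, so the product of probabilities is first exhibited as one. *)
have [r r0 cE] : exists2 r : R, (0 <= r)%R & c = r%:E.
  rewrite /c; elim/big_rec: _ => [|i _ _ [r r0 ->]]; first by exists 1%R.
  exists (fine (P (X i @^-1` B i)) * r)%R; first by rewrite mulr_ge0// fine_ge0.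
  rewrite EFinM fineK// fin_num_measure// -[_ @^-1` _]setTI; exact: mX.
rewrite cE (_ : r = (NngNum r0)%:num%R) // muleC.
apply: (@measure_prod_ext _ _ E R R (pushforward (mrestr P mD) ZX)
  (mscale (NngNum r0) (distribution P ZX)) _ _ A mA).
- rewrite /= /pushforward /mrestr/=; apply: (@le_lt_trans _ _ 1) => //; last
    exact: ltry.
  by apply: probability_le1; rewrite preimage_setT setTI.
- move=> F1 F2 mF1 mF2; rewrite /mscale /pushforward /mrestr /=.
  rewrite -[LHS]/(P (Z @^-1` F1 `&` X k @^-1` F2 `&` D)).
  rewrite -[RHS]/(r%:E * P (Z @^-1` F1 `&` X k @^-1` F2)).
  (* Slot [k] of [B] is [setT] because k < k.+1, hence free to receive [F2]. *)
  pose C i := if i == k then F2 else B i.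
  have -> : Z @^-1` F1 `&` X k @^-1` F2 `&` D =
      Z @^-1` F1 `&` \bigcap_(i in [set: 'I_n]) (X i @^-1` C i).
    rewrite -setIA; congr (_ `&` _); apply/seteqP; split => [w [Fw Dw] i _|w Cw].
      by rewrite /C/=; case: eqP => [->//|_]; exact: Dw.
    split; first by have /= := Cw k I; rewrite /C eqxx.
    move=> i _; have /= := Cw i I; rewrite /C; case: eqP => // -> _.
    by rewrite BT.
  rewrite iZ//; last 2 first.
  + by move=> i; rewrite /C; case: ifP.
  + move=> i ik; rewrite /C ifF; last by apply/eqP => e; move: ik; rewrite e ltnn.
    by rewrite BT// (ltn_trans ik).
  rewrite indep_tail_pair//. rewrite muleCA; congr (_ * _); rewrite muleC.
  rewrite -cE /c (bigD1 k)//= [in RHS](bigD1 k)//= {1}/C eqxx BT// preimage_setT.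
  rewrite probability_setT mul1e; congr (_ * _); apply: eq_bigr => i /negbTE ik.
  by rewrite /C ik.
Qed.

(** The pair has the product of the marginal laws, so Tonelli applies. The inner variable [w']
    ranges over the same space and acts as an independent copy. *)
Lemma indep_tail_integral (f : E * R -> \bar R) :
  measurable_fun setT f -> (forall z, 0 <= f z) ->
  \int[P]_w f (Z w, X k w) = \int[P]_w \int[P]_w' f (Z w, X k w').
Proof.
move=> mf f0.
transitivity (\int[(distribution P Z' \x distribution P Xk)%E]_z f z).
  rewrite -[RHS]/(\int[(distribution P Z' \x distribution P Xk)%E]_z f (idfun z)).
  apply: eq_law_integral => //; first exact: measurable_id.
  move=> A mA; rewrite preimage_id.
  apply: esym; rewrite -[RHS]/(distribution P ZX A).
  apply: product_measure_unique => // F1 F2 mF1 mF2.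
  exact: indep_tail_pair.
rewrite fubini_tonelli1//=.
rewrite (_ : \int[P]_w \int[P]_w' _ =
    \int[P]_w (fun z => \int[distribution P Xk]_x f (z, x)) (Z w)).
  rewrite -[LHS]/(\int[distribution P Z']_z (fun z => \int[distribution P Xk]_x
      f (z, x)) (idfun z)).
  apply: eq_law_integral => //; last by move=> x; exact: integral_ge0.
  - exact: measurable_id.
  - exact: (measurable_fun_fubini_tonelli_F f).
apply: eq_integral => w _.
rewrite -[RHS]/(\int[distribution P Xk]_x f (Z w, idfun x)).
rewrite -[LHS]/(\int[P]_w' (fun x => f (Z w, x)) (X k w')).
apply: eq_law_integral => //.
- exact: measurable_id.
- exact: (measurableT_comp mf (pair1_measurable _)).
Qed.

End step.
End independence.

(** * Spitzer's identity *)

Lemma measurable_integral_snd d1 d2 (T1 : measurableType d1) (T2 : measurableType d2)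
    (R : realType) (m : probability T2 R) (f : T1 -> T2 -> \bar R) :
  measurable_fun setT (fun z : T1 * T2 => f z.1 z.2) ->
  (forall x y, 0 <= f x y)%E ->
  measurable_fun setT (fun x => \int[m]_y f x y)%E.
Proof.
move=> mf f0.
exact: (@measurable_fun_fubini_tonelli_F _ _ _ _ _ m (fun z : T1 * T2 => f z.1 z.2)).
Qed.

Lemma probability_integral_cst d (T : measurableType d) (R : realType) (P :
    probability T R)
    (c : \bar R) : (\int[P]_w c = c)%E.
Proof.
rewrite (@integral_cst _ _ _ P _ measurableT).
by rewrite -[RHS]mule1; congr (_ * _)%E; exact: probability_setT.
Qed.

Lemma ge0_integral_swap d1 d2 (T1 : measurableType d1) (T2 : measurableType d2)
    (R : realType) (m1 : probability T1 R) (m2 : probability T2 R)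
    (f : T1 -> T2 -> \bar R) :
  measurable_fun setT (fun z : T1 * T2 => f z.1 z.2) ->
  (forall x y, 0 <= f x y)%E ->
  (\int[m1]_x \int[m2]_y f x y = \int[m2]_y \int[m1]_x f x y)%E.
Proof.
move=> mf f0.
exact: (@fubini_tonelli _ _ _ _ _ m1 m2 (fun z : T1 * T2 => f z.1 z.2)).
Qed.

Lemma measurable_comp_fst d1 d2 d3 (T1 : measurableType d1)
    (T2 : measurableType d2) (T3 : measurableType d3) (X : T1 -> T3) :
  measurable_fun setT X -> measurable_fun setT (fun z : T1 * T2 => X z.1).
Proof. by move=> mX; exact: (measurableT_comp mX measurable_fst). Qed.

Lemma measurable_comp_snd d1 d2 d3 (T1 : measurableType d1)
    (T2 : measurableType d2) (T3 : measurableType d3) (X : T2 -> T3) :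
  measurable_fun setT X -> measurable_fun setT (fun z : T1 * T2 => X z.2).
Proof. by move=> mX; exact: (measurableT_comp mX measurable_snd). Qed.

Arguments measurable_comp_fst {d1 d2 d3 T1} T2 {T3 X}.
Arguments measurable_comp_snd {d1 d2 d3} T1 {T2 T3 X}.

Section running_maximum.
Context {R : realType}.

(** The indices run from 0 to [n] inclusive; for a path started at 0 the entry [y 0] supplies the 0
    of the maximum. Peeling off the first value rather than the last makes the step of the reflected
    walk a mere unfolding. *)
Fixpoint rmax (y : nat -> R) (n : nat) : R :=
  if n is m.+1 then Num.max (y 0%N) (rmax (fun i => y i.+1) m) else y 0%N.

Lemma rmax_ge y n i : (i <= n)%N -> y i <= rmax y n.
Proof.
elim: n y i => [|n IHn] y [|i] //= ; rewrite ?le_max ?lexx //.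
by move=> ni; rewrite (IHn (fun i => y i.+1)) ?orbT.
Qed.

Lemma rmax_attained y n : exists2 i, (i <= n)%N & rmax y n = y i.
Proof.
elim: n y => [|n IHn] y /=; first by exists 0%N.
have [i ni ->] := IHn (fun i => y i.+1).
by case: leP => _; [exists i.+1|exists 0%N].
Qed.

Lemma measurable_rmax d (T : measurableType d) (Z : nat -> T -> R) n :
  (forall i, measurable_fun setT (Z i)) ->
  measurable_fun setT (fun w => rmax (Z ^~ w) n).
Proof.
elim: n Z => [|n IHn] Z mZ /=; first exact: mZ.
by apply: measurable_maxr => //; apply: (IHn (fun i => Z i.+1)).
Qed.

Lemma rmaxZ (c : R) y n : 0 <= c -> rmax (fun i => c * y i) n = c * rmax y n.
Proof.
move=> c0; elim: n y => [|n IHn] y //=.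
by rewrite (IHn (fun i => y i.+1)) -maxr_pMr.
Qed.

End running_maximum.

(** Telescoping in additive form, since the terms may be infinite and have no differences. *)
Lemma sume_telescope (R : realType) (s t a : nat -> \bar R) n :
  (forall j, (j < n)%N -> s j + a j = t j + a j.+1)%E ->
  (\sum_(j < n) s j + a 0%N = \sum_(j < n) t j + a n)%E.
Proof.
elim: n => [|n IHn] sta; first by rewrite !big_ord0.
rewrite !big_ord_recr/= addeAC IHn; last by move=> j jn; rewrite sta// ltnW.
by rewrite -addeA -[RHS]addeA; congr (_ + _)%E; rewrite addeC sta.
Qed.

Definition posp (R : realType) (x : R) : R := Num.max 0 x.

Lemma measurable_posp d (T : measurableType d) (R : realType) (X : T -> R) :
  measurable_fun setT X -> measurable_fun setT (fun w => posp (X w)).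
Proof. exact: measurable_maxr. Qed.

Section random_walk.
Context d (T : measurableType d) (R : realType) (P : probability T R).
Context (Y : R -> {RV P >-> R}) (LY : levy_process Y).
Implicit Types f : R -> \bar R.

Let M n w := rmax (fun i => Y i%:R w) n.

Let measurable_M n : measurable_fun setT (M n).
Proof. by apply: (@measurable_rmax R _ _ (fun i => Y i%:R)) => i. Qed.

(** Transition operator of the reflected walk z -> (X_1 + z)^+. *)
Let step f z := (\int[P]_w f (posp (Y 1 w + z)))%E.

Let mstep f : measurable_fun setT f -> (forall x, 0 <= f x)%E ->
  measurable_fun setT (step f).
Proof.
move=> mf f0; apply: (@measurable_integral_snd _ _ R T R P (fun z w => f (posp
    (Y 1 w + z)))) => //.
apply: (measurableT_comp mf); apply: measurable_posp => //.
by apply: measurable_funD => //; exact: measurableT_comp.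
Qed.

Let step_ge0 f : (forall x, 0 <= f x)%E -> forall x, (0 <= step f x)%E.
Proof. by move=> f0 x; exact: integral_ge0. Qed.

Let rev_incr N (i : 'I_N) w := Y (N - i)%:R w - Y (N - i.+1)%:R w.

Let rev_incr_indep N : independent P (@rev_incr N).
Proof.
have t0 : 0 <= (fun i => i%:R : R) 0%N by [].
have tS i : (i%:R : R) <= i.+1%:R by rewrite ler_nat.
have := independent_rev (levy_indep LY t0 tS (n := N)).
congr independent; apply/funext => i; apply/funext => w.
by rewrite /rev_incr/= subnSK.
Qed.

(** Maximum over the last [k] steps of a walk of length [N], seen from its value at time N - k. It
    depends only on the first [k] reversed increments, and for k = N it is [M N]. *)
Let refl N k w := rmax (fun i => Y (N - k + i)%:R w) k - Y (N - k)%:R w.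

(** Starting one step earlier shifts all previous entries by the new increment and adds the new
    starting point, which contributes 0. *)
Let reflS N (k : 'I_N) w :
  refl N k.+1 w = posp (rev_incr k w + refl N k w).
Proof.
rewrite /refl /=; set a := rmax _ _; set b := rmax _ _.
have -> : a = b.
  rewrite /a /b; congr rmax; apply/funext => i; congr (Y _%:R w).
  have := ltn_ord k; lia.
rewrite addn0 /rev_incr addr_maxl subrr addrC; congr Num.max.
by ring.
Qed.

Let measurable_refl N k : measurable_fun setT (refl N k).
Proof.
apply: measurable_funB => //.
by apply: (@measurable_rmax R _ _ (fun i => Y (N - k + i)%:R)) => i.
Qed.

Let measurable_rev_incr N (i : 'I_N) : measurable_fun setT (rev_incr i).
Proof. exact: measurable_funB. Qed.

Let Eiter n f := iter n step f 0.

(** One induction carries both claims: integrating out the next reversed increment uses its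
    independence from [refl N k], and [indep_tailS] passes that independence on. *)
Let refl_law N k : (k <= N)%N -> indep_tail P (@rev_incr N) k (refl N k) /\
  forall f, measurable_fun setT f -> (forall x, 0 <= f x)%E ->
    (\int[P]_w f (refl N k w) = Eiter k f)%E.
Proof.
elim: k => [_|k IHk kN].
  have -> : refl N 0 = cst 0.
    by apply/funext => w; rewrite /refl/= addn0 subrr.
  split; first exact: indep_tail_cst.
  by move=> f mf f0; exact: (probability_integral_cst P (f 0%R)).
have [iW eW] := IHk (ltnW kN).
pose K := Ordinal kN.
have mg : measurable_fun setT (fun z : R * R => posp (z.2 + z.1)).
  by apply: measurable_posp; exact: measurable_funD.
have -> : refl N k.+1 =
    (fun z => posp (z.2 + z.1)) \o (fun w => (refl N k w, rev_incr K w)).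
  by apply/funext => w; rewrite (reflS K).
split.
  apply: indep_tail_comp mg _.
  by apply: (@indep_tailS _ _ _ _ _ _ _ _ _ K).
move=> f mf f0.
have mfg := measurableT_comp mf mg.
rewrite (indep_tail_integral (k := K) _ _ iW mfg)//; last by move=> z; exact: f0.
transitivity (\int[P]_w step f (refl N k w))%E.
  apply: eq_integral => w _.
  pose h x := f (posp (x + refl N k w)).
  apply: (@eq_law_integral _ _ _ R R T T P P (rev_incr K) (Y 1) h) => //.
  - move=> A mA.
    (* As k < N, this increment spans exactly one unit of time. *)
    have := levy_stationary LY (s := (N - k.+1)%:R) (t := (N - k)%:R).
    rewrite ler0n ler_nat leq_sub2l// => /(_ isT isT A mA).
    by rewrite -natrB ?leq_sub2l// /pushforward (_ : (N - k - (N - k.+1))%N =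
        1%N)//; lia.
  - apply: (measurableT_comp mf); apply: measurable_posp.
    exact: measurable_funD.
- by move=> x; exact: f0.
rewrite eW//; [|exact: mstep|exact: step_ge0].
by rewrite /Eiter iterSr.
Qed.

Let M_law n f : measurable_fun setT f -> (forall x, 0 <= f x)%E ->
  (\int[P]_w f (M n w) = Eiter n f)%E.
Proof.
move=> mf f0; rewrite -(refl_law (leqnn n)).2//; apply: eq_integral => w _.
rewrite /refl subnn levy_start// subr0; congr (f (rmax _ _)).

Qed.

(** Both sides are the same iterate of [step] at 0. In the double integral [Y 1 u] stands for a step
    independent of [M n w]. *)
Lemma lindley n f : measurable_fun setT f -> (forall x, 0 <= f x)%E ->
  (\int[P]_w f (M n.+1 w) = \int[P]_w \int[P]_u f (posp (Y 1 u + M n w)%R))%E.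
Proof.
move=> mf f0; rewrite M_law// /Eiter iterSr -/(Eiter n _) -M_law//.
- exact: mstep.
- exact: step_ge0.
Qed.

Lemma levy_incr2 n f : measurable_fun setT f -> (forall x, 0 <= f x)%E ->
  (\int[P]_w f (Y n.+1%:R%R w) = \int[P]_u \int[P]_w f (Y 1 u + Y n%:R w)%R)%E.
Proof.
move=> mf f0.
(* Times 0, n, n + 1, constant afterwards: the two increments are Y_n and one fresh step. *)
pose t i : R := if i == 0%N then 0 else if i == 1%N then n%:R else n.+1%:R.
have t0 : 0 <= t 0%N by [].
have tS i : t i <= t i.+1.
  by case: i => [|[|i]]; rewrite /t/= ?ler0n ?ler_nat.
have iX := levy_indep LY t0 tS (n := 2).
set X := fun _ => _ in iX.
have mX i : measurable_fun setT (X i) by exact: measurable_funB.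
have X0 : X ord0 = Y n%:R.
  by apply/funext => w; rewrite /X /t/= levy_start// subr0.
have i0 := indep_tail_cst tt iX.
have i1 := indep_tailS (k := ord0) (measurable_cst tt) mX i0.
have {}i1 : indep_tail P X 1 (Y n%:R).
  rewrite -X0.
  have msnd : measurable_fun setT (snd : unit * R -> R) by [].
  exact: (indep_tail_comp msnd i1).
have mD : measurable_fun setT (fun z : R * R => z.2 + z.1).
  exact: measurable_funD.
have mfD := measurableT_comp mf mD.
have := indep_tail_integral (k := ord_max) _ mX i1 mfD (fun z => f0 _).
move=> /(_ (measurable_funP _)).
move=> /= H; transitivity (\int[P]_w f (X ord_max w + Y n%:R w)%R)%E.
  by apply: eq_integral => w _; rewrite /X/= /t/= subrK.
pose g u w := f (Y 1 u + Y n%:R w).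
rewrite H (ge0_integral_swap P P (f := g)); last 2 first.
- apply: (measurableT_comp mf); apply: measurable_funD.
    exact: (measurable_comp_fst T (measurable_funP (Y 1))).
  exact: (measurable_comp_snd _ (measurable_funP (Y n%:R))).
- by move=> *; exact: f0.
apply: eq_integral => w _.
apply: (@eq_law_integral _ _ _ R R T T P P (X ord_max) (Y 1) (fun x => f (x + Y
    n%:R w)%R)) => //.
- move=> A mA.
  have := levy_stationary LY (s := n%:R) (t := n.+1%:R).
  rewrite ler0n ler_nat leqnSn => /(_ isT isT A mA).
  by rewrite -natrB// subSnn.
- by apply: (measurableT_comp mf); exact: measurable_funD.
Qed.

(** Spitzer's summand, followed by the companion term that will telescope. *)
Let split_term j k f := (\int[P]_w \int[P]_w' f (M j w + posp (Y k%:R w'))%R)%E.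
Let join_term j k f := (\int[P]_w \int[P]_w' f (posp (M j w + Y k%:R w')%R))%E.

Lemma ge0_integral2D d1 d2 (T1 : measurableType d1) (T2 : measurableType d2)
    (m1 : probability T1 R) (m2 : probability T2 R)
    (g1 g2 : T1 -> T2 -> \bar R) :
  measurable_fun setT (fun z : T1 * T2 => g1 z.1 z.2) ->
  measurable_fun setT (fun z : T1 * T2 => g2 z.1 z.2) ->
  (forall x y, 0 <= g1 x y)%E -> (forall x y, 0 <= g2 x y)%E ->
  (\int[m1]_x \int[m2]_y (g1 x y + g2 x y) =
   \int[m1]_x \int[m2]_y g1 x y + \int[m1]_x \int[m2]_y g2 x y)%E.
Proof.
move=> mg1 mg2 g10 g20.
rewrite -ge0_integralD//; first last.
- exact: measurable_integral_snd.
- by move=> x _; exact: integral_ge0.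
- exact: measurable_integral_snd.
- by move=> x _; exact: integral_ge0.
apply: eq_integral => x _; rewrite ge0_integralD//.
- exact: (measurableT_comp mg1 (pair1_measurable x)).
- exact: (measurableT_comp mg2 (pair1_measurable x)).
Qed.

(** In each of the four sign cases the two arguments on the left are, up to order, those on the
    right; this is why an arbitrary [f] is allowed. *)
Lemma posp_rota_baxter (x y : R) (f : R -> \bar R) :
  (f (posp x + posp y)%R + f (posp (x + y)) =
   f (posp (x + posp y)%R) + f (posp (posp x + y)%R))%E.
Proof.
rewrite /posp; have [x0|x0] := leP 0 x; have [y0|y0] := leP 0 y.
- by rewrite (max_r (addr_ge0 x0 y0)).
- by rewrite addr0 (max_r x0).
- by rewrite !add0r (max_r y0) addeC.
- by rewrite !addr0 !add0r !max_l// ?ltW//; lra.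
Qed.

Lemma ge0_integral3D (g1 g2 : T -> T -> T -> \bar R) :
  measurable_fun setT (fun z : T * T * T => g1 z.1.1 z.1.2 z.2) ->
  measurable_fun setT (fun z : T * T * T => g2 z.1.1 z.1.2 z.2) ->
  (forall x y z, 0 <= g1 x y z)%E -> (forall x y z, 0 <= g2 x y z)%E ->
  (\int[P]_x \int[P]_y \int[P]_z (g1 x y z + g2 x y z) =
   \int[P]_x \int[P]_y \int[P]_z g1 x y z + \int[P]_x \int[P]_y \int[P]_z g2 x y z)%E.
Proof.
move=> mg1 mg2 g10 g20.
rewrite -ge0_integral2D.
- apply: eq_integral => x _; apply: eq_integral => y _; rewrite ge0_integralD//.
  + exact: (measurableT_comp mg1 (pair1_measurable (x, y))).
  + exact: (measurableT_comp mg2 (pair1_measurable (x, y))).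
- exact: (@measurable_integral_snd _ _ (T * T)%type T R P (fun z => g1 z.1 z.2)).
- exact: (@measurable_integral_snd _ _ (T * T)%type T R P (fun z => g2 z.1 z.2)).
- by move=> x y; exact: integral_ge0.
- by move=> x y; exact: integral_ge0.
Qed.

(** The pointwise identity is integrated at x = X_1 + M_j and y = S'_k. By Lindley x^+ is M_(j+1) in
    law, which gives the terms of index j + 1; x + y is M_j + S'_(k+1) in law; and x + y^+ is M_j +
    y^+ after one more step, whence [step f]. *)
Let rota_baxter j k f : measurable_fun setT f -> (forall x, 0 <= f x)%E ->
  (split_term j.+1 k f + join_term j k.+1 f =
   split_term j k (step f) + join_term j.+1 k f)%E.
Proof.
move=> mf f0.
have mM := measurable_M j.
pose x w u := Y 1 u + M j w.
pose a1 w u w' := f (posp (x w u) + posp (Y k%:R w')).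
pose a2 w u w' := f (posp (x w u + Y k%:R w')).
pose b1 w u w' := f (posp (x w u + posp (Y k%:R w'))).
pose b2 w u w' := f (posp (posp (x w u) + Y k%:R w')).
pose I3 g := (\int[P]_w \int[P]_u \int[P]_w' g w u w')%E.
have S1 : split_term j.+1 k f = I3 a1.
  pose h z := (\int[P]_w' f (z + posp (Y k%:R w'))%R)%E.
  apply: (@lindley j h); last by move=> z; exact: integral_ge0.
  apply: measurable_integral_snd => //; apply: (measurableT_comp mf).
  apply: measurable_funD => //; apply: measurable_posp.
  exact: measurableT_comp.
have J2 : join_term j.+1 k f = I3 b2.
  pose h z := (\int[P]_w' f (posp (z + Y k%:R w')%R))%E.
  apply: (@lindley j h); last by move=> z; exact: integral_ge0.
  apply: measurable_integral_snd => //; apply: (measurableT_comp mf).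
  apply: measurable_posp; apply: measurable_funD => //.
  exact: measurableT_comp.
have J1 : join_term j k.+1 f = I3 a2.
  apply: eq_integral => w _.
  pose h x := f (posp (M j w + x)%R).
  have mh : measurable_fun setT h.
    by apply: (measurableT_comp mf); apply: measurable_posp; exact: measurable_funD.
  have := levy_incr2 k mh (fun x => f0 _); rewrite /h => ->.
  apply: eq_integral => u _; apply: eq_integral => w' _.
  by rewrite /a2 /x; congr (f (posp _)); ring.
have S2 : split_term j k (step f) = I3 b1.
  apply: eq_integral => w _.
  pose g w' u := f (posp (Y 1 u + (M j w + posp (Y k%:R w')))).
  apply: etrans (ge0_integral_swap P P (f := g) _ _) _.
  - apply: (measurableT_comp mf); apply: measurable_posp; apply: measurable_funD.
      exact: (measurable_comp_snd _ (measurable_funP (Y 1))).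
    apply: measurable_funD; first exact: measurable_cst.
    exact: (measurable_comp_fst _ (measurable_posp (measurable_funP (Y k%:R)))).
  - by move=> *; exact: f0.
  apply: eq_integral => u _; apply: eq_integral => w' _.
  by rewrite /b1 /x /g; congr (f (posp _)); ring.
have mY1 := measurable_comp_fst T (measurable_comp_snd T (measurable_funP (Y 1))).
have mMj := measurable_comp_fst T (measurable_comp_fst T mM).
have mYk := measurable_comp_snd (T * T)%type (measurable_funP (Y k%:R)).
have mx : measurable_fun setT (fun z : T * T * T => x z.1.1 z.1.2).
  exact: measurable_funD mY1 mMj.
have mpx := measurable_posp mx.
have mpYk := measurable_posp mYk.
have ma1 := measurableT_comp mf (measurable_funD mpx mpYk).
have ma2 := measurableT_comp mf (measurable_posp (measurable_funD mx mYk)).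
have mb1 := measurableT_comp mf (measurable_posp (measurable_funD mx mpYk)).
have mb2 := measurableT_comp mf (measurable_posp (measurable_funD mpx mYk)).
have Ea := @ge0_integral3D a1 a2 ma1 ma2 (fun _ _ _ => f0 _) (fun _ _ _ => f0 _).
have Eb := @ge0_integral3D b1 b2 mb1 mb2 (fun _ _ _ => f0 _) (fun _ _ _ => f0 _).
rewrite S1 J1 S2 J2; apply: etrans (esym Ea) (etrans _ Eb).
apply: eq_integral => w _; apply: eq_integral => u _; apply: eq_integral => w' _.
exact: posp_rota_baxter.
Qed.

(** Induction on [n] for all [f] at once, because a Lindley step replaces [f] by [step f]. *)
Let spitzer_sum n f : (0 < n)%N -> measurable_fun setT f -> (forall x, 0 <= f x)%E ->
  (\sum_(j < n) split_term j (n - j) f = n%:R%:E * \int[P]_w f (M n w))%E.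
Proof.
elim: n f => [//|n IHn] f _ mf f0.
(* The summands of index j + 1 for [f] are matched with Spitzer's sum of length [n] for [step f];
   the joined terms telescope from j = 0 to j = n. *)
have tele := @sume_telescope R (fun j => split_term j.+1 (n - j) f)
  (fun j => split_term j (n - j) (step f)) (fun j => join_term j (n.+1 - j) f) n.
have {}tele := tele (fun j jn => etrans
  (congr1 (fun k => _ + join_term j k f)%E (subSn (ltnW jn)))
  (rota_baxter j (n - j) mf f0)).
(* Ends of the telescope: at j = 0, M_0 = 0 turns the joined term into the missing first summand; at
   j = n one step is left and Lindley produces M_(n+1). *)
have s0 : split_term 0 n.+1 f = join_term 0 n.+1 f.
  apply: eq_integral => w _; apply: eq_integral => w' _; congr f.
  by rewrite /M/= levy_start// !add0r.
have jn : join_term n (n.+1 - n) f = (\int[P]_w f (M n.+1 w))%E.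
  rewrite subSnn; apply: etrans (esym (lindley n mf f0)).
  apply: eq_integral => w _; apply: eq_integral => u _.
  by congr (f (posp _)); rewrite addrC.
rewrite big_ord_recl subn0 addeC s0.
apply: etrans tele _; rewrite jn.
(* The induction hypothesis provides [n] copies of E f(M_(n+1)), the end of the telescope one
   more. *)
rewrite -[n.+1%:R]natr1 EFinD ge0_muleDl ?lee_fin// mul1e; congr (_ + _)%E.
have [->|n0] := posnP n; first by rewrite big_ord0 mul0e.
apply: etrans (IHn (step f) n0 (mstep mf f0) (step_ge0 f0)) _; congr (_ * _)%E.
exact: esym (lindley n mf f0).
Qed.

(* Coefficientwise form of the logarithmic derivative of Spitzer's identity. *)
Lemma spitzer n f : (0 < n)%N -> measurable_fun setT f -> (forall x, 0 <= f x)%E ->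
  (\sum_(j < n) \int[P]_w \int[P]_w'
      f (rmax (fun i => Y i%:R w) j + posp (Y (n - j)%:R w'))%R =
   n%:R%:E * \int[P]_w f (rmax (fun i => Y i%:R w) n))%E.
Proof. exact: spitzer_sum. Qed.

End random_walk.

(** * Scaling *)

Section path_law.
Context d (T : measurableType d) (R : realType) (P : probability T R).

Let G : set (set (R -> R)) := [set C | exists (t : R) (A : set R),
  [/\ 0 <= t, measurable A & C = [set y | A (y t)]]].

Let measurable_eval (t : R) : 0 <= t ->
  measurable_fun setT ((fun y => y t) : g_sigma_algebraType G -> R).
Proof.
move=> t0 _ A mA; rewrite setTI; apply: sub_sigma_algebra.
by exists t, A.
Qed.

(** At times t i >= 0 a finite maximum is measurable for the cylinder sigma-algebra. The case n = 0
    yields the one-time marginals. *)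
Lemma eq_path_law_rmax (X Z : R -> T -> R) (t : nat -> R) n (A : set R) :
  eq_path_law P X Z -> (forall i, 0 <= t i) -> measurable A ->
  P [set w | A (rmax (fun i => X (t i) w) n)] =
  P [set w | A (rmax (fun i => Z (t i) w) n)].
Proof.
move=> XZ t0 mA; apply: (XZ [set y | A (rmax (fun i => y (t i)) n)]).
have mt i : measurable_fun setT ((fun y => y (t i)) : g_sigma_algebraType G -> R).
  exact: measurable_eval.
have := measurable_rmax n mt measurableT mA.
by rewrite setTI.
Qed.

End path_law.
Section stable.
Context d (T : measurableType d) (R : realType) (P : probability T R).
Context (alpha rho : R) (Y : R -> {RV P >-> R}).
Hypothesis (SY : stable_process alpha rho Y).

Let LY := stable_levy SY.
Let beta := alpha^-1.

Definition grid_max n w := rmax (fun i => Y (i%:R / n%:R) w) n.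

Lemma measurable_grid_max n : measurable_fun setT (grid_max n).
Proof. by apply: (@measurable_rmax R _ _ (fun i => Y (i%:R / n%:R))) => i. Qed.

Let M n w := rmax (fun i => Y i%:R w) n.

Let measurable_walk_max n : measurable_fun setT (M n).
Proof. by apply: (@measurable_rmax R _ _ (fun i => Y i%:R)) => i. Qed.

(** Self-similarity with c = n, read at the times i / n. *)
Let grid_max_law n A : measurable A ->
  P (M n @^-1` A) = P ((fun w => n%:R `^ beta * grid_max n w) @^-1` A).
Proof.
move=> mA; have [->|n0] := posnP n.
  congr (P _); apply/seteqP; split => w;
  by rewrite /preimage/= /M /grid_max/= mul0r levy_start// mulr0.
have c0 : 0 <= n%:R :> R by [].
have Sn := stable_scaling SY c0.
have t0 i : 0 <= i%:R / n%:R :> R by rewrite divr_ge0.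
have := eq_path_law_rmax n Sn t0 mA.
have -> : [set w | A (rmax (fun i => Y (n%:R * (i%:R / n%:R)) w) n)] = M n @^-1` A.
  have E w : (fun i => Y (n%:R * (i%:R / n%:R)) w) = (fun i => Y i%:R w).
    by apply/funext => i; rewrite mulrC divfK// pnatr_eq0 -lt0n.
  by apply/seteqP; split => w /=; rewrite E.
move=> ->; congr (P _); apply/seteqP; split => w /=;
by rewrite rmaxZ ?powR_ge0.
Qed.

Let marginal_law k A : measurable A ->
  P (Y k%:R @^-1` A) = P ((fun w => k%:R `^ beta * Y 1 w) @^-1` A).
Proof.
move=> mA; have k0 : 0 <= k%:R :> R by [].
have := eq_path_law_rmax 0 (stable_scaling SY k0) (fun=> ler01) mA.
by rewrite /= mulr1.
Qed.

(** Spitzer's identity for the function f(n^(-beta) x): the scales j^beta and (n - j)^beta of its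
    two parts become (j / n)^beta and (1 - j / n)^beta. *)
Lemma grid_max_recursion n f : (0 < n)%N ->
  measurable_fun setT f -> (forall x, 0 <= f x)%E ->
  (\sum_(j < n) \int[P]_w \int[P]_w'
      f ((j%:R / n%:R) `^ beta * grid_max j w +
         (1 - j%:R / n%:R) `^ beta * posp (Y 1 w'))%R =
   n%:R%:E * \int[P]_w f (grid_max n w))%E.
Proof.
move=> n0 mf f0.
have n0' : n%:R != 0 :> R by rewrite pnatr_eq0 -lt0n.
pose c := (n%:R^-1 : R) `^ beta.
pose g x := f (c * x).
have mg : measurable_fun setT g by apply: (measurableT_comp mf); exact: measurable_funM.
have g0 x : (0 <= g x)%E by exact: f0.
have <- : (\int[P]_w g (M n w) = \int[P]_w f (grid_max n w))%E.
  rewrite (eq_law_integral (measurable_walk_max n) _ (grid_max_law n) mg g0).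
    apply: eq_integral => w _; rewrite /g mulrA -powRM ?invr_ge0//.
    by rewrite mulVf// powR1 mul1r.
  by apply: measurable_funM => //; exact: measurable_grid_max.
apply: etrans _ (spitzer LY n0 mg g0); apply: eq_bigr => j _.
pose h x := (\int[P]_w' g (x + posp (Y (n - j)%:R w'))%R)%E.
have mh : measurable_fun setT h.
  apply: measurable_integral_snd => //; apply: (measurableT_comp mg).
  apply: measurable_funD => //.
  exact: (measurable_comp_snd R (measurable_posp (measurable_funP (Y (n - j)%:R)))).
have h0 x : (0 <= h x)%E by exact: integral_ge0.
have mcD : measurable_fun setT (fun w => j%:R `^ beta * grid_max j w).
  by apply: measurable_funM => //; exact: measurable_grid_max.
apply: esym; apply: etrans (eq_law_integral (measurable_walk_max j) mcD
    (grid_max_law j) mh h0) _.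
apply: eq_integral => w _; rewrite /h.
pose h2 y := g (j%:R `^ beta * grid_max j w + posp y).
have mh2 : measurable_fun setT h2.
  apply: (measurableT_comp mg); apply: measurable_funD => //.
  by apply: measurable_posp.
have mcY : measurable_fun setT (fun w => (n - j)%:R `^ beta * Y 1 w).
  by apply: measurable_funM.
apply: etrans (eq_law_integral (measurable_funP (Y (n - j)%:R)) mcY
    (marginal_law (n - j)) mh2 (fun y => g0 _)) _.
apply: eq_integral => w' _; rewrite /h2 /g; congr f.
rewrite mulrDr mulrA -powRM ?invr_ge0// [_^-1 * _]mulrC; congr (_ + _).
have -> : (1 - j%:R / n%:R : R) = n%:R^-1 * (n - j)%:R.
  by rewrite natrB ?(ltnW (ltn_ord j))// mulrBr mulVf// mulrC.
rewrite powRM ?invr_ge0// -mulrA; congr (_ * _).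
by rewrite /posp maxr_pMr ?powR_ge0// mulr0.
Qed.

End stable.

(** * Suprema of cadlag functions *)

Section cadlag_supremum.
Context {R : realType}.
Implicit Types f : R -> R.

(** Near each point of [0, 1] a bound comes from right continuity, from the left limit and from the
    value at the point. The bound is treated as a parameter tending to infinity, so that the
    near-covering form of compactness makes it uniform. *)
Lemma cadlag_bounded f : cadlag f ->
  exists b, forall s, 0 <= s <= 1 -> f s <= b.
Proof.
move=> [fr fl].
have K : compact `[0 : R, 1]%classic by exact: segment_compact.
move/compact_near_coveringP : K => K.
pose Q (i x : R) := 0 <= x <= 1 -> f x <= i.
have h (x : R) : `[0, 1]%classic x -> \forall x' \near x & i \near +oo, Q i x';
    last first.
  have [b [_ bK]] := K _ _ Q _ h.
  (* A property holding near [+oo] is only known strictly above [b]. *)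
  exists (b + 1) => s s01; apply: (bK (b + 1)) => //=; first by rewrite ltrDl.
rewrite /= in_itv/= => /andP[x0 x1].
have [b1 H1] : exists b, \forall y \near x, x < y -> f y <= b.
  exists (f x + 1).
  have /cvgrPdist_lt /(_ 1 ltr01) := fr x x0.
  rewrite /at_right near_withinE; apply: filterS => y + xy => /(_ xy).
  by rewrite ltr_distlC => /andP[_ /ltW].
have [b2 H2] : exists b, \forall y \near x, y < x -> 0 <= y -> f y <= b.
  (* No left limit is given at 0, but there no y < x satisfies 0 <= y. *)
  move: x0; rewrite le_eqVlt => /predU1P[<-|x0].
    by exists 0; near=> y => /lt_le_trans /[apply]; rewrite ltxx.
  have /cvg_ex[l fxl] := fl x x0.
  exists (l + 1).
  have /cvgrPdist_lt /(_ 1 ltr01) := fxl.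
  rewrite /at_left near_withinE; apply: filterS => y + yx y0 => /(_ yx).
  by rewrite ltr_distlC => /andP[_ /ltW].
pose b := Num.max (f x) (Num.max b1 b2).
exists ([set y | (x < y -> f y <= b1) /\ (y < x -> 0 <= y -> f y <= b2)],
  [set i | b <= i]).
  split => /=; first by near=> y; split; near: y.
  by apply: nbhs_pinfty_ge; rewrite num_real.
move=> [y i] /= [[h1 h2] bi] /andP[y0 y1].
apply: le_trans bi; rewrite /b !le_max.
have [yx|xy|->] := ltgtP y x; last by rewrite lexx.
- by rewrite h2 ?orbT.
- by rewrite h1 ?orbT.
Unshelve. all: by end_near. Qed.

Lemma cadlag_has_sup f : cadlag f -> has_sup [set f s | s in `[0, 1]].
Proof.
move=> cf; split; first by exists (f 0), 0 => //=; rewrite in_itv/= lexx ler01.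
have [b fb] := cadlag_bounded cf; exists b => _ [s s01 <-].
by apply: fb; move: s01; rewrite /= in_itv.
Qed.

(** Grid points lie in [0, 1], so the supremum is an upper bound. Conversely, a near-optimal time s
    < 1 can be moved slightly to the right onto the grid by right continuity. *)
Lemma cadlag_grid_max_cvg f : cadlag f ->
  rmax (fun i => f (i%:R / n%:R)) n @[n --> \oo] --> sup [set f s | s in `[0, 1]].
Proof.
move=> cf; have fsup := cadlag_has_sup cf.
apply/cvgrPdist_lt => e e0.
have [_ [s + <-] fs] := sup_adherent e0 fsup.
rewrite /= in_itv/= => /andP[s0 s1].
set m := sup _ in fs *.
have le_m n : rmax (fun i => f (i%:R / n%:R)) n <= m.
  have [i ni ->] := rmax_attained (fun i => f (i%:R / n%:R)) n.
  apply: ub_le_sup; first by case: fsup.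
  exists (i%:R / n%:R) => //=; rewrite in_itv/= divr_ge0//=.
  (* For n = 0 the quotient is 0 by convention, still a point of [0, 1]. *)
  have [->|n0] := posnP n; first by rewrite invr0 mulr0 ler01.
  by rewrite ler_pdivrMr ?ltr0n// mul1r ler_nat.
suff : \forall n \near \oo, m - e < rmax (fun i => f (i%:R / n%:R)) n.
  apply: filterS => n mn; rewrite ger0_norm ?subr_ge0//.
  by rewrite ltrBlDr addrC -ltrBlDr.
(* There is no room to the right of s = 1, but 1 = n / n is itself on every grid. *)
move: s1; rewrite le_eqVlt => /predU1P[s1|s1].
  near=> n; apply: lt_le_trans fs _.
  have n0 : (0 < n)%N by near: n; exact: nbhs_infty_gt.
  have /= := @rmax_ge R (fun i => f (i%:R / n%:R)) n n (leqnn n).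
  by rewrite divff ?pnatr_eq0 -?lt0n// s1.
have : \forall y \near s^'+, m - e < f y.
  have := cf.1 s s0.
  move=> /cvgr_gt; exact.
rewrite /at_right near_withinE => /nbhs_ballP[d /= d0 sd].
near=> n.
have n0 : (0 < n)%N by near: n; exact: nbhs_infty_gt.
have n0' : 0 < n%:R :> R by rewrite ltr0n.
(* [d] keeps the grid point in the right neighbourhood of [s], and 1 - s keeps its index at most
   [n]. *)
have e'0 : 0 < Num.min d (1 - s) by rewrite lt_min d0 subr_gt0.
have : n%:R^-1 < Num.min d (1 - s).
  by rewrite invf_plt//; near: n; exact: nbhs_infty_gtr.
rewrite lt_min => /andP[nd ns].
(* The first grid index strictly to the right of [s], at distance at most 1 / n; points before [s]
   are not controlled. *)
pose i := (Num.truncn (n%:R * s)).+1.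
have ns0 : 0 <= n%:R * s by rewrite mulr_ge0.
have i1 : n%:R * s < i%:R by exact: truncnS_gt.
have i2 : i%:R <= n%:R * s + 1 by rewrite /i -natr1 lerD2r truncn_le.
have si : s < i%:R / n%:R by rewrite ltr_pdivlMr// mulrC.
have is' : i%:R / n%:R <= s + n%:R^-1.
  by rewrite ler_pdivrMr// mulrDl mulVf ?gt_eqF// mulrC.
have i_n : (i <= n)%N.
  have : i%:R / n%:R <= 1 :> R by lra.
  by rewrite ler_pdivrMr// mul1r ler_nat.
apply: lt_le_trans (rmax_ge (fun i => f (i%:R / n%:R)) i_n).
apply: (sd (i%:R / n%:R)) => //=.
by rewrite -ball_normE/= ltr0_norm ?subr_lt0//; lra.
Unshelve. all: by end_near. Qed.

End cadlag_supremum.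

Section bounded_convergence.
Local Open Scope ereal_scope.

Lemma bounded_cvg d (T : measurableType d) (R : realType)
    (mu : {measure set T -> \bar R}) (D : set T) (f_ : nat -> T -> \bar R)
    (f : T -> \bar R) :
  measurable D -> mu D < +oo ->
  (forall n, measurable_fun D (f_ n)) -> measurable_fun D f ->
  (forall n x, D x -> 0 <= f_ n x <= 1) ->
  (forall x, D x -> f_ n x @[n --> \oo] --> f x) ->
  \int[mu]_(x in D) f_ n x @[n --> \oo] --> \int[mu]_(x in D) f x.
Proof.
move=> mD muD mf_ mf f01 f_f.
have [] := @dominated_convergence _ _ _ mu D mD f_ f (cst 1) mf_ mf _ _ _; last by [].
- by apply/aeW => x; exact: f_f.
- apply/integrableP; split; first exact: measurable_cst.
  under eq_integral do rewrite abse1.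
  by rewrite integral_cst// mul1e.
- apply/aeW => x n Dx; have /andP[f0 f1] := f01 n x Dx.
  by rewrite gee0_abs.
Qed.

End bounded_convergence.

(** * The uniform law *)

Lemma powR_continuous_at (R : realType) (beta u : R) : 0 < u ->
  {for u, continuous (fun x : R => x `^ beta)}.
Proof.
move=> u0; apply/differentiable_continuous/derivable1_diffP.
by apply: derivable_powR; rewrite in_itv/= u0.
Qed.

(* [uniform_prob] is a measure for a measurable structure on [R] that differs
   from the canonical one by its display, hence this repackaging. *)
Definition uniform01 (R : realType) : set R -> \bar R :=
  uniform_prob (@ltr01 R).

Arguments uniform01 : clear implicits.

Section uniform01_probability.
Context {R : realType}.
Let unif := uniform_prob (@ltr01 R).

HB.instance Definition _ := isMeasure.Build _ R R (@uniform01 R)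
  (measure0 unif) (measure_ge0 unif) (@measure_semi_sigma_additive _ _ _ unif).

HB.instance Definition _ := @Measure_isProbability.Build _ R R (@uniform01 R)
  (@probability_setT _ _ _ unif).

Lemma uniform01E (f : R -> \bar R) :
  measurable_fun setT f -> (forall x, 0 <= f x)%E ->
  (\int[uniform01 R]_x f x = \int[unif]_x f x)%E.
Proof.
move=> mf f0.
apply: (@eq_law_integral _ _ _ R R _ _ (uniform01 R) unif idfun idfun f) => //;
  by move=> _ A mA; rewrite setTI.
Qed.

End uniform01_probability.

Section uniform.
Local Open Scope ereal_scope.
Context {R : realType}.
Local Notation leb := (@lebesgue_measure R).
Local Notation unif := (uniform01 R).

Lemma integral_uniform01 (f : R -> \bar R) :
  measurable_fun setT f -> (forall x, 0 <= f x) ->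
  \int[unif]_x f x = \int[leb]_(x in `]0%R, 1%R[) f x.
Proof.
move=> mf f0; rewrite uniform01E// integral_uniform// subr0 invr1 mul1e.
by rewrite integral_itv_bndoo//; exact: measurable_funTS.
Qed.

Lemma measurable_truncn : measurable_fun setT (@Num.truncn R).
Proof.
have mle m : measurable [set x : R | (Num.truncn x <= m)%N].
  (* [Num.truncn] is 0 on negative reals, so sublevel sets are unbounded below. *)
  rewrite (_ : [set _ | _] = `]-oo, m.+1%:R[%classic)//.
  by apply/seteqP; split => x /=; rewrite in_itv/= truncn_le_nat.
move=> _ A _; rewrite setTI.
rewrite (_ : _ @^-1` A = \bigcup_(k in A) [set x : R | Num.truncn x = k]); last first.
  by apply/seteqP; split => [x Ax|x [k Ak /= kx]]; [exists (Num.truncn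
      x)|rewrite /= kx].
apply: bigcup_measurable => -[|k] _.
  rewrite (_ : [set _ | _] = [set x : R | (Num.truncn x <= 0)%N])//.
  by apply/seteqP; split => x /= => [->//|]; rewrite leqn0 => /eqP.
rewrite (_ : [set _ | _] = [set x : R | (Num.truncn x <= k.+1)%N] `\`
  [set x : R | (Num.truncn x <= k)%N]); first exact: measurableD.
apply/seteqP; split => x /=; first by move=> ->; split => //; apply/negP; rewrite ltnn.
by move=> [xk /negP]; rewrite -ltnNge => kx; apply/eqP; rewrite eqn_leq xk kx.
Qed.

(** The integer part of n U is uniform on {0, ..., n - 1}; this is how the index of Spitzer's sum
    becomes a uniform variable. *)
Lemma integral_step (H : nat -> \bar R) (n : nat) : (0 < n)%N ->
  (forall j, 0 <= H j) ->
  n%:R%:E * \int[unif]_u H (Num.truncn (n%:R * u)%R) = \sum_(j < n) H j.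
Proof.
move=> n0 H0.
have n0' : (0 < n%:R :> R)%R by rewrite ltr0n.
pose g (u : R) := H (Num.truncn (n%:R * u)%R).
have mg : measurable_fun setT g.
  apply: (@measurableT_comp _ _ _ _ _ _ H) => //.
  apply: (measurableT_comp measurable_truncn).
  exact: measurable_funM.
rewrite -[X in _ * X]/(\int[unif]_u g u) uniform01E//; last by move=> u; exact: H0.
rewrite (integral_uniform (@ltr01 R) mg (fun u => H0 _)).
rewrite subr0 invr1 mul1e -integral_itv_bndo_bndc; last exact: measurable_funTS.
(* Induction on the right endpoint m / n, one cell of length 1 / n at a time; m = n gives the unit
   interval. Half-open intervals make the cells disjoint. *)
suff step m : n%:R%:E * \int[leb]_(u in `[0%R, (m%:R / n%:R)%R[) g u = \sum_(j < m) H j.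
  by rewrite -step divff// gt_eqF.
elim: m => [|m IHm].
  by rewrite mul0r set_itv_ge ?bnd_simp ?ltxx// integral_set0 mule0 big_ord0.
have mn : (m%:R / n%:R < m.+1%:R / n%:R :> R)%R by rewrite ltr_pM2r ?invr_gt0// ltr_nat.
have -> : `[0%R, (m.+1%:R / n%:R)%R[%classic =
    `[0%R, (m%:R / n%:R)%R[%classic `|` `[(m%:R / n%:R)%R, (m.+1%:R /
        n%:R)%R[%classic :> set R.
  have m0 : (0 <= m%:R / n%:R :> R)%R by rewrite divr_ge0.
  apply/seteqP; split => x /=; rewrite !in_itv/=.
    by case: (ltP x (m%:R / n%:R)%R) => _ /andP[x0 x1]; [left|right]; rewrite ?x0.
  by case=> /andP[x0 x1]; apply/andP; split => //; [exact: lt_trans mn|exact: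
      le_trans x0].
rewrite ge0_integral_setU//; last 3 first.
- exact: measurable_funTS.
- by move=> x _; exact: H0.
- by apply/disj_setPS => x [] /=; rewrite !in_itv/= => /andP[_ xm] /andP[];
    rewrite leNgt xm.
rewrite ge0_muleDr; last 2 first.
- by apply: integral_ge0 => x _; exact: H0.
- by apply: integral_ge0 => x _; exact: H0.
rewrite big_ord_recr/=; congr (_ + _); first exact: IHm.
rewrite (eq_integral (cst (H m))); last first.
  move=> x; rewrite inE/= in_itv/= => /andP[mx xm]; rewrite /g; congr H.
  apply: truncn_def; rewrite mulrC.
  by rewrite -ler_pdivrMr// mx -ltr_pdivlMr.
rewrite integral_cst//= lebesgue_measure_itv/= lte_fin mn -EFinB muleCA -EFinM.
by rewrite -mulrBl -natrB// subSnn mul1r divff ?gt_eqF// mule1.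
Qed.

End uniform.

(** * Passage to the limit *)

Section limits.
Context {R : realType}.

Lemma powR_cvg (beta u : R) (a : nat -> R) : 0 < u ->
  a n @[n --> \oo] --> u -> a n `^ beta @[n --> \oo] --> u `^ beta.
Proof.
move=> u0 au.
exact: continuous_cvg (powR_continuous_at u0) au.
Qed.

Lemma truncn_div_cvg (u : R) : 0 <= u ->
  (Num.truncn (n%:R * u))%:R / n%:R @[n --> \oo] --> u.
Proof.
move=> u0; apply: (@squeeze_cvgr _ _ _ _ (fun n => u - n%:R^-1) (fun=> u)).
- near=> n.
  have n0 : 0 < n%:R :> R by rewrite ltr0n; near: n; exact: nbhs_infty_gt.
  have nu0 : 0 <= n%:R * u by rewrite mulr_ge0.
  have /andP[t1 t2] := truncn_itv nu0.
  apply/andP; split.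
    rewrite ler_pdivlMr// mulrBl mulVf ?gt_eqF// lerBlDr [u * _]mulrC.
    by apply: ltW; rewrite natr1.
  by rewrite ler_pdivrMr// [u * _]mulrC.
- rewrite -[X in _ --> X]subr0; apply: cvgB; first exact: cvg_cst.
  rewrite gtr0_cvgV0; first exact: cvgr_idn.
  by near=> n; rewrite ltr0n; near: n; exact: nbhs_infty_gt.
- exact: cvg_cst.
Unshelve. all: by end_near. Qed.

Lemma truncn_cvg_infty (u : R) : 0 < u ->
  Num.truncn (n%:R * u) @[n --> \oo] --> \oo.
Proof.
move=> u0; apply/cvgnyPge => N; near=> n.
rewrite truncn_ge_nat; last by rewrite mulr_ge0// ltW.
rewrite -ler_pdivrMr//; near: n; exact: nbhs_infty_ger.
Unshelve. all: by end_near. Qed.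

Lemma integral_itv01 d (T : measurableType d) (m : probability T R)
    (f : T -> \bar R) : measurable_fun setT f ->
  (forall x, 0 <= f x <= 1)%E -> (0 <= \int[m]_x f x <= 1)%E.
Proof.
move=> mf f01; have f0 x : (0 <= f x)%E by case/andP : (f01 x).
apply/andP; split; first exact: integral_ge0.
rewrite -[leRHS](probability_integral_cst m 1%E); apply: ge0_le_integral => //.
by move=> x _; case/andP : (f01 x).
Qed.

End limits.

Section sup_equation.
Context d (T : measurableType d) (R : realType) (P : probability T R).
Context (alpha rho : R) (Y : R -> {RV P >-> R}).
Hypothesis (SY : stable_process alpha rho Y).

Let beta := alpha^-1.
Local Notation unif := (uniform01 R).

Lemma grid_max_cvg w : grid_max Y n w @[n --> \oo] --> sup01 Y w.
Proof. exact: (cadlag_grid_max_cvg (levy_cadlag (stable_levy SY) w)). Qed.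

Lemma measurable_sup01 : measurable_fun setT (sup01 Y).
Proof.
apply: (@measurable_fun_cvg _ _ _ setT (fun n => grid_max Y n)).
- by move=> n; exact: measurable_grid_max.
- by move=> w _; exact: grid_max_cvg.
Qed.

(** With j the integer part of n u, the average over j < n is an integral over u; as n grows, j / n
    tends to u and j to infinity, so the grid maximum converges to the supremum. Bounded convergence
    is used in u, in w and in w'. *)
Lemma sup01_equation (f : R -> R) : continuous f -> (forall x, 0 <= f x <= 1) ->
  (\int[P]_w (f (sup01 Y w))%:E =
   \int[unif]_u \int[P]_w \int[P]_w'
     (f (u `^ beta * sup01 Y w + (1 - u) `^ beta * posp (Y 1 w')))%:E)%E.
Proof.
move=> cf f01.
have mf : measurable_fun setT f by exact: continuous_measurable_fun.
have mEf : measurable_fun setT (EFin \o f) by exact/measurable_EFinP.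
have Ef01 x : (0 <= (f x)%:E <= 1)%E by rewrite !lee_fin.
have Ef0 x : (0 <= (f x)%:E)%E by case/andP : (Ef01 x).
pose F (M : T -> R) v w w' := (f (v `^ beta * M w + (1 - v) `^ beta * posp (Y 1
    w')))%:E.
pose G M v := (\int[P]_w \int[P]_w' F M v w w')%E.
have mF M v w : measurable_fun setT (F M v w).
  apply: (measurableT_comp mEf); apply: measurable_funD => //.
  apply: measurable_funM => //; exact: measurable_posp.
have F01 M v w w' : (0 <= F M v w w' <= 1)%E by exact: Ef01.
have F0 M v w w' : (0 <= F M v w w')%E by exact: Ef0.
have mF2 M v : measurable_fun setT M ->
    measurable_fun setT (fun w => \int[P]_w' F M v w w')%E.
  move=> mM; apply: measurable_integral_snd => //; apply: (measurableT_comp mEf).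
  apply: measurable_funD; apply: measurable_funM => //.
    exact: measurable_comp_fst.
  exact: (measurable_comp_snd T (measurable_posp (measurable_funP (Y 1)))).
have mD n := measurable_grid_max Y n.
have mS := measurable_sup01.
have G01 M v : measurable_fun setT M -> (0 <= G M v <= 1)%E.
  move=> mM; apply: integral_itv01; first exact: mF2.
  by move=> w; exact: integral_itv01.
pose H n j := G (grid_max Y j) (j%:R / n%:R).
have H01 n j : (0 <= H n j <= 1)%E by exact: G01.
have H0 n j : (0 <= H n j)%E by case/andP : (H01 n j).
pose J n (u : R) := H n (Num.truncn (n%:R * u)).
have mJ n : measurable_fun setT (J n).
  apply: (@measurableT_comp _ _ _ _ _ _ (H n)) => //.
  by apply: (measurableT_comp measurable_truncn); exact: measurable_funM.
have grid n : (0 < n)%N ->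
    (\int[P]_w (f (grid_max Y n w))%:E = \int[unif]_u J n u)%E.
  move=> n0.
  have n0' : (0 < (n%:R : R)%:E)%E by rewrite lte_fin ltr0n.
  have := integral_step n0 (H0 n); rewrite -[X in (_ * X)%E]/(\int[unif]_u J n
      u)%E => E.
  have {E} := etrans E (grid_max_recursion SY n0 mEf Ef0).
  by move/(congr1 (fun x => (n%:R^-1%:E * x)%E)); rewrite !muleA -EFinM mulVf
      ?mul1e// pnatr_eq0 -lt0n.
have lhs : (\int[P]_w (f (grid_max Y n w))%:E)%E @[n --> \oo] -->
    (\int[P]_w (f (sup01 Y w))%:E)%E.
  apply: (bounded_cvg (mu := P) (D := setT) (f_ := fun n w => (f (grid_max Y n w))%:E)
    (f := fun w => (f (sup01 Y w))%:E)) => //.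
  - by rewrite (le_lt_trans (probability_le1 _ _)) ?ltry.
  - by move=> n; exact: (measurableT_comp mEf (mD n)).
  - exact: (measurableT_comp mEf mS).
  - move=> w _; apply: cvg_EFin; first exact: nearW.
    apply: continuous_cvg; first exact: cf.
    exact: grid_max_cvg.
pose K (u : R) := G (sup01 Y) u.
have mK : measurable_fun setT K.
  pose F3 (z : R * T * T) := F (sup01 Y) z.1.1 z.1.2 z.2.
  have mF3 : measurable_fun setT F3.
    have mu : measurable_fun setT (fun z : R * T * T => z.1.1).
      exact: (measurable_comp_fst T measurable_fst).
    apply: (measurableT_comp mEf); apply: measurable_funD; apply: measurable_funM.
    - exact: (measurableT_comp (measurable_powR beta) mu).
    - exact: (measurable_comp_fst T (measurable_comp_snd R mS)).
    - apply: (measurableT_comp (measurable_powR beta)); exact: measurable_funB.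
    - exact: (measurable_comp_snd (R * T)%type (measurable_posp
        (measurable_funP (Y 1)))).
  apply: measurable_integral_snd; last by move=> *; exact: integral_ge0.
  by apply: (@measurable_integral_snd _ _ (R * T)%type T R P (fun z w' => F
      (sup01 Y) z.1 z.2 w')).
have EK := integral_uniform01 mK (fun u => proj1 (andP (G01 _ u mS))).
have EJ n := integral_uniform01 (mJ n) (fun u => H0 n _).
have rhs : (\int[lebesgue_measure]_(u in `]0%R, 1%R[) J n u)%E @[n --> \oo] -->
    (\int[lebesgue_measure]_(u in `]0%R, 1%R[) K u)%E.
  have moo : (lebesgue_measure (`]0%R, 1%R[%classic : set R) < +oo)%E.
    by rewrite /= lebesgue_measure_itv/= lte_fin ltr01 -EFinB ltry.
  apply: (@bounded_cvg _ _ R lebesgue_measure _ J K _ moo).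
  - exact: measurable_itv.
  - by move=> n; exact: measurable_funTS (mJ n).
  - exact: measurable_funTS mK.
  - by move=> n u _; exact: (H01 n (Num.truncn (n%:R * u))).
  (* Continuity of the power requires u > 0 and 1 - u > 0, and u > 0 also sends the integer part of
     n u to infinity. *)
  move=> u /=; rewrite in_itv/= => /andP[u0 u1].
  pose a n : R := (Num.truncn (n%:R * u))%:R / n%:R.
  have ca : a n @[n --> \oo] --> u by apply: truncn_div_cvg; exact: ltW.
  have ca1 : (1 - a n) @[n --> \oo] --> 1 - u by apply: cvgB => //; exact: cvg_cst.
  have cab := powR_cvg (beta := beta) u0 ca.
  have u1' : 0 < 1 - u by rewrite subr_gt0.
  have ca1b := powR_cvg (beta := beta) u1' ca1.
  pose D n := grid_max Y (Num.truncn (n%:R * u)).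
  have cD w : D n w @[n --> \oo] --> sup01 Y w.
    apply: (@cvg_comp _ _ _ (fun n => Num.truncn (n%:R * u)) (fun m => grid_max Y m w)).
      exact: truncn_cvg_infty.
    exact: grid_max_cvg.
  have Poo : (P setT < +oo)%E by rewrite (le_lt_trans (probability_le1 _ _)) ?ltry.
  apply: (bounded_cvg (mu := P) (D := setT) (f_ := fun n w => (\int[P]_w' F (D
      n) (a n) w w')%E)
    (f := fun w => (\int[P]_w' F (sup01 Y) u w w')%E)) => [|||||w _].
  - exact: measurableT.
  - exact: Poo.
  - by move=> n; apply: mF2; exact: mD.
  - exact: mF2.
  - by move=> n w _; apply: integral_itv01; [exact: mF|exact: F01].
  apply: (bounded_cvg (mu := P) (D := setT) (f_ := fun n w' => F (D n) (a n) w w')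
    (f := fun w' => F (sup01 Y) u w w')) => [|||||w' _].
  - exact: measurableT.
  - exact: Poo.
  - by move=> n; exact: mF.
  - exact: mF.
  - by move=> n w' _; exact: F01.
  apply: cvg_EFin; first exact: nearW.
  apply: continuous_cvg; first exact: cf.
  apply: cvgD; apply: cvgM => //; exact: cvg_cst.
transitivity (\int[lebesgue_measure]_(u in `]0%R, 1%R[) K u)%E; last exact: esym EK.
apply: (cvg_unique _ lhs); first exact: ereal_hausdorff.
apply: cvg_trans rhs; apply: near_eq_cvg; near=> n.
have n0 : (0 < n)%N by near: n; exact: nbhs_infty_gt.
exact: esym (etrans (grid n n0) (EJ n)).
Unshelve. all: by end_near. Qed.

End sup_equation.

(** * Laws are determined by Lipschitz test functions *)

Section determination.
Context {R : realType}.
Implicit Types m : {measure set R -> \bar R}.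

Lemma measure_ray_ext m m' : (m setT < +oo)%E ->
  (forall x, m `]x, +oo[%classic = m' `]x, +oo[%classic) ->
  forall A, measurable A -> m A = m' A.
Proof.
move=> moo mm' A mA.
pose G : set (set R) := [set A | exists x, A = `]x, +oo[%classic].
apply: (measure_unique G (fun n => `](- n%:R), +oo[%classic)) => //.
- exact: RGenOInfty.measurableE.
- move=> _ _ [x ->] [y ->]; exists (Num.max x y).
  by apply/seteqP; split => z /=; rewrite !in_itv/= !andbT gt_max => /andP.
- by move=> n; exists (- n%:R).
- rewrite -subTset => x _; exists (Num.truncn (- x)).+1 => //=.
  by rewrite in_itv/= andbT ltrNl truncnS_gt.
- by move=> _ [x ->].
- move=> n; apply: le_lt_trans moo; apply: le_measure => //; rewrite inE//.
Qed.

(** One-sided form: exchanging [x] and [y] gives the absolute value, and the inequality can be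
    integrated without subtraction. *)
Definition lipschitz_le (L : R) (f : R -> R) :=
  forall x y, f x <= f y + L * `|x - y|.

Lemma lipschitz_le_continuous L f : lipschitz_le L f -> continuous f.
Proof.
move=> fL x; apply/cvgrPdist_le => e e0.
have L0 : 0 < `|L| + 1 by rewrite ltr_wpDl.
have : \forall y \near x, `|x - y| < e / (`|L| + 1).
  apply/nbhs_ballP; exists (e / (`|L| + 1)); first by rewrite /= divr_gt0.
  by move=> y; rewrite -ball_normE.
apply: filterS => y xy.
have h : (`|L| + 1) * `|x - y| <= e by rewrite mulrC -ler_pdivlMr// ltW.
have h2 : L * `|x - y| <= (`|L| + 1) * `|x - y|.
  by rewrite ler_wpM2r// (le_trans (ler_norm _))// lerDl.
have := fL x y; have := fL y x; rewrite distrC => h3 h4.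
by rewrite ler_distl; lra.
Qed.

(** For n > 0 it rises linearly from 0 at [x] to 1 at x + 1 / n; the limit is the indicator of the
    open ray. *)
Let ramp (x : R) n y : R := Num.min 1 (Num.max 0 (n%:R * (y - x))).

Let ramp_lipschitz x n : lipschitz_le n%:R (ramp x n).
Proof.
move=> y z; rewrite /ramp.
have : n%:R * (y - x) <= n%:R * (z - x) + n%:R * `|y - z|.
  rewrite -mulrDr ler_wpM2l//; have := ler_norm (y - z); lra.
have : 0 <= n%:R * `|y - z| by rewrite mulr_ge0.
move: (n%:R * (y - x)) (n%:R * (z - x)) (n%:R * `|y - z|) => a b c c0 abc.
by case: (leP 0 a) => ?; case: (leP 0 b) => ?; case: (leP 1 a) => ?;
  case: (leP 1 b) => ?; case: (leP (1 : R) 0) => ?; lra.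
Qed.

Let ramp01 x n y : 0 <= ramp x n y <= 1.
Proof.
by rewrite /ramp le_min ler01 le_max lexx /= ge_min lexx.
Qed.

Let ramp_cvg x y : (ramp x n y)%:E @[n --> \oo] --> (\1_`]x, +oo[ y)%:E.
Proof.
apply: cvg_EFin; first exact: nearW.
apply: cvg_near_cst; near=> n.
rewrite indicE; have [yx|xy] := leP y x.
  rewrite memNset/=; last by rewrite in_itv/= andbT => xy; move: (lt_le_trans
      xy yx); rewrite ltxx.
  rewrite /ramp max_l ?min_r//; apply: mulr_ge0_le0 => //; lra.
rewrite mem_set/=; last by rewrite in_itv/= xy.
rewrite /ramp min_l// le_max; apply/orP; right.
rewrite -ler_pdivrMr ?subr_gt0//; near: n; exact: nbhs_infty_ger.
Unshelve. all: by end_near. Qed.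

(** Ramps recover the mass of each open ray in the limit, and open rays determine a finite
    measure. *)
Lemma lipschitz_law_ext m m' : (m setT < +oo)%E -> (m' setT < +oo)%E ->
  (forall L f, lipschitz_le L f -> (forall x, 0 <= f x <= 1) ->
    (\int[m]_x (f x)%:E = \int[m']_x (f x)%:E)%E) ->
  forall A, measurable A -> m A = m' A.
Proof.
move=> moo m'oo mm'; apply: measure_ray_ext => // x.
have cv (m0 : {measure set R -> \bar R}) : (m0 setT < +oo)%E ->
    (\int[m0]_y (ramp x n y)%:E)%E @[n --> \oo] --> m0 `]x, +oo[%classic.
  move=> m0oo; have <- : (\int[m0]_y (\1_`]x, +oo[ y)%:E = m0 `]x, +oo[%classic)%E.
    by rewrite integral_indic//= setIT.
  apply: (@bounded_cvg _ _ _ m0 setT (fun n y => (ramp x n y)%:E)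
     (fun y => (\1_`]x, +oo[ y)%:E)) => //.
  - move=> n; apply/measurable_EFinP; apply: continuous_measurable_fun.
    exact: lipschitz_le_continuous (ramp_lipschitz x n).
  - exact/measurable_EFinP/measurable_indic.
  - by move=> n y _; rewrite !lee_fin.
have := cv m moo; under eq_fun do rewrite (mm' _ _ (ramp_lipschitz x _) (ramp01 x _)).
move=> c1; exact: (cvg_unique _ c1 (cv m' m'oo)).
Qed.

End determination.

(** * The law of V^(1/rho) *)

Section power_law.
Context {R : realType} (rho : R).
Hypothesis rho01 : 0 < rho < 1.
Local Notation unif := (uniform01 R).
Local Notation leb := (@lebesgue_measure R).

Let rho0 : 0 < rho. Proof. by case/andP : rho01. Qed.
Let rho1 : rho < 1. Proof. by case/andP : rho01. Qed.

Let tail (x y : R) : \bar R := if x < y then 1%E else 0%E.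

Let tail_ge0 x y : (0 <= tail x y)%E. Proof. by rewrite /tail; case: ifP. Qed.

Let measurable_tail d (T : measurableType d) (x : T -> R) (X : T -> R) :
  measurable_fun setT x ->
  measurable_fun setT X -> measurable_fun setT (fun w => tail (x w) (X w)).
Proof.
by move=> mx mX; apply: measurable_fun_ifT => //; exact: measurable_fun_ltr.
Qed.

Let measurable_Vpow : measurable_fun setT (fun v : R => v `^ rho^-1).
Proof. exact: measurable_powR. Qed.

Lemma uniform_tail (c : R) : 0 <= c <= 1 -> (\int[unif]_u tail c u = (1 - c)%:E)%E.
Proof.
move=> /andP[c0 c1].
rewrite integral_uniform01//; last exact: measurable_tail.
transitivity (\int[leb]_(u in `]0%R, 1%R[) (\1_`]c, +oo[ u)%:E)%E.
  apply: eq_integral => u _; rewrite /tail /= indicE; case: ifPn => cu.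
    by rewrite mem_set//= in_itv/= cu.
  by rewrite memNset//= in_itv/= andbT; exact/negP.
rewrite integral_indic//= (_ : `]c, +oo[%classic `&` _ = `]c, 1%R[%classic).
  by rewrite lebesgue_measure_itv/= lte_fin; case: ltP => // c1'; congr EFin; lra.
apply/seteqP; split => u /=; rewrite !in_itv/= ?andbT.
  by move=> [-> /andP[_ ->]].
by move=> /andP[cu u1]; rewrite cu u1 (le_lt_trans c0).
Qed.

Let ltr_powV (x v : R) : 0 <= x -> 0 < v -> (x < v `^ rho^-1) = (x `^ rho < v).
Proof.
move=> x0 v0; set y := v `^ rho^-1.
have y0 : 0 <= y by exact: powR_ge0.
have <- : y `^ rho = v by rewrite -powRrM mulVf ?gt_eqF// powRr1// ltW.
apply/idP/idP => [xy|]; first by apply: gt0_ltr_powR.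
apply: contraTT; rewrite -!leNgt => yx.
by apply: ge0_ler_powR => //; rewrite ltW.
Qed.

Lemma uniform_pow_tail (x : R) : 0 <= x <= 1 ->
  (\int[unif]_v tail x (v `^ rho^-1) = (1 - x `^ rho)%:E)%E.
Proof.
move=> /andP[x0 x1].
rewrite -uniform_tail; last first.
  rewrite powR_ge0/= -[leRHS](_ : 1 `^ rho = 1); last by rewrite powR1.
  by apply: ge0_ler_powR => //; rewrite ?nnegrE// ltW.
rewrite !integral_uniform01//; [|exact: measurable_tail..].
apply: eq_integral => v; rewrite inE/= in_itv/= => /andP[v0 _].
by rewrite /tail ltr_powV.
Qed.


(** This is P(U V^(1/rho) > x): given U = u > x, the tail is 1 - (x / u)^rho. *)
Let integral_tail_pow (x : R) : 0 < x < 1 ->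
  (\int[leb]_(u in `[x, 1%R]) (1 - x `^ rho * u `^ (- rho))%:E =
   (1 - x - (x `^ rho - x) / (1 - rho))%:E)%E.
Proof.
move=> /andP[x0 x1].
have r1 : 1 - rho != 0 by rewrite gt_eqF// subr_gt0.
pose F (u : R) := u - x `^ rho / (1 - rho) * u `^ (1 - rho).
have dF (u : R) : 0 < u -> is_derive u 1 F (1 - x `^ rho * u `^ (- rho)).
  move=> u0.
  have dp := is_derive1_powR (1 - rho) u0.
  apply: is_derive_eq.
  rewrite /GRing.scale/= (_ : 1 - rho - 1 = - rho); last by ring.
  by rewrite mulrA divfK.
have cF (u : R) : 0 < u -> {for u, continuous F}.
  move=> u0; apply/differentiable_continuous/derivable1_diffP.
  exact: (@ex_derive _ _ _ _ _ _ _ (dF u u0)).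
rewrite (@continuous_FTC2 _ (fun u => 1 - x `^ rho * u `^ (- rho)) F)//.
- rewrite -EFinB /F powR1 mulr1; congr EFin.
  rewrite -mulrA [_^-1 * _]mulrC mulrA -powRD; last by apply/implyP => _;
      rewrite gt_eqF.
  rewrite addrCA subrr addr0 powRr1 ?ltW//; field; exact: r1.
- apply: continuous_in_subspaceT => u; rewrite inE/= in_itv/= => /andP[xu _].
  have u0 : 0 < u by exact: lt_le_trans xu.
  apply: cvgB; first exact: cvg_cst.
  apply: cvgM; first exact: cvg_cst.
  exact: powR_continuous_at.
- split.
  + move=> u; rewrite in_itv/= => /andP[xu _].
    exact: (@ex_derive _ _ _ _ _ _ _ (dF u (lt_trans x0 xu))).
  + exact/cvg_at_right_filter/cF.
  + exact/cvg_at_left_filter/cF.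
- move=> u; rewrite in_itv/= => /andP[xu _].
  by rewrite derive1E; exact: (@derive_val _ _ _ _ _ _ _ (dF u (lt_trans x0 xu))).
Qed.

Let uniform_const (f : R -> \bar R) (c : \bar R) :
  measurable_fun setT f -> (forall x, 0 <= f x)%E ->
  (forall u, 0 < u < 1 -> f u = c) -> (\int[unif]_u f u = c)%E.
Proof.
move=> mf f0 fc; rewrite integral_uniform01//.
transitivity (\int[leb]_(u in `]0%R, 1%R[) c)%E.
  by apply: eq_integral => u; rewrite inE/= in_itv/= => u01; exact: fc.
rewrite integral_cst//= lebesgue_measure_itv/= lte_fin ltr01.
by rewrite -EFinB subr0 mule1.
Qed.

Let powV_bounds (v : R) : 0 < v < 1 -> 0 < v `^ rho^-1 < 1.
Proof.
move=> /andP[v0 v1]; rewrite powR_gt0//=.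
rewrite -[ltRHS](_ : 1 `^ rho^-1 = 1); last by rewrite powR1.
by apply: gt0_ltr_powR; rewrite ?invr_gt0// nnegrE// ltW.
Qed.

(** The mixture on a space with a coin of success probability rho and independent U, V: U on
    success, U V^(1/rho) on failure. *)
Let Z (z : bool * R * R) : R := if z.1.1 then z.1.2 else z.1.2 * z.2 `^ rho^-1.

Let mZ : measurable_fun setT Z.
Proof.
have m11 : measurable_fun setT (fun z : bool * R * R => z.1.1).
  exact: (measurable_comp_fst R measurable_fst).
have m12 : measurable_fun setT (fun z : bool * R * R => z.1.2).
  exact: (measurable_comp_fst R measurable_snd).
apply: measurable_fun_ifT => //.
apply: measurable_funM => //.
exact: (measurable_comp_snd (bool * R)%type measurable_Vpow).
Qed.

Let Q0 : probability (bool * R)%type R :=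
  ((bernoulli_prob rho : probability bool R) \x unif)%E.

Let Q : probability (bool * R * R)%type R := (Q0 \x unif)%E.

Let Q_integral (g : R -> \bar R) : measurable_fun setT g -> (forall x, 0 <= g x)%E ->
  (\int[Q]_z g (Z z) = rho%:E * \int[unif]_u g u +
   (1 - rho)%:E * \int[unif]_u \int[unif]_v g (u * v `^ rho^-1)%R)%E.
Proof.
move=> mg g0; have mgZ := measurableT_comp mg mZ.
pose h b u v := g (Z (b, u, v)).
transitivity (\int[bernoulli_prob rho]_b \int[unif]_u \int[unif]_v h b u v)%E.
  pose k (p : bool * R) := (\int[unif]_v h p.1 p.2 v)%E.
  have mk : measurable_fun setT k.
    apply: (@measurable_integral_snd _ _ (bool * R)%type R R unif (fun p v => h
        p.1 p.2 v)).
      by apply: (eq_measurable_fun (g \o Z)) => // -[[b u] v] _.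
    by move=> *; exact: g0.
  transitivity (\int[Q0]_p k p)%E.
    apply: etrans (@fubini_tonelli1 _ _ _ _ _ Q0 unif _ mgZ (fun z => g0 _)) _.
    by apply: eq_integral => -[b u] _.
  apply: etrans (@fubini_tonelli1 _ _ _ _ _ (bernoulli_prob rho) unif _ mk _) _ => //.
  by move=> p; apply: integral_ge0 => v _; exact: g0.
rewrite integral_bernoulli_prob; last 2 first.
- by rewrite !ltW.
- by move=> b; apply: integral_ge0 => u _; apply: integral_ge0 => v _; exact: g0.
congr (_ * _ + _)%E.
by apply: eq_integral => u _; apply: etrans (probability_integral_cst unif (g u)).
Qed.

Let measurable_inner (g : R -> \bar R) : measurable_fun setT g ->
  (forall x, 0 <= g x)%E ->
  measurable_fun setT (fun u : R => \int[unif]_v g (u * v `^ rho^-1)%R)%E.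
Proof.
move=> mg g0; apply: (@measurable_integral_snd _ _ R R R unif (fun u v : R => g
    (u * v `^ rho^-1)%R)) => //.
apply: (measurableT_comp mg); apply: measurable_funM => //.
exact: (measurable_comp_snd R measurable_Vpow).
Qed.

(** For 0 < x < 1 this is 1 - x^rho = rho (1 - x) + (1 - rho) (1 - x - (x^rho - x) / (1 - rho)). *)
Let tail_mixture x :
  (\int[unif]_v tail x (v `^ rho^-1) = \int[Q]_z tail x (Z z))%E.
Proof.
have mt : measurable_fun setT (tail x) by exact: measurable_tail.
have mtV : measurable_fun setT (fun v => tail x (v `^ rho^-1)) by exact:
    measurable_tail.
have mt2 (u : R) : measurable_fun setT (fun v => tail x (u * v `^ rho^-1)).
  by apply: measurable_tail => //; exact: measurable_funM.
have mI := measurable_inner mt (tail_ge0 x).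
have I0 (u : R) : (0 <= \int[unif]_v tail x (u * v `^ rho^-1)%R)%E by exact:
    integral_ge0.
rewrite (Q_integral mt (tail_ge0 x)).
(* All variables lie in ]0, 1[ almost surely, so the tails are 1 for x <= 0 and 0 for x >= 1. *)
have [x0|x0] := leP x 0.
  have tail1 y : 0 < y -> tail x y = 1%E by move=> y0; rewrite /tail
      (le_lt_trans x0 y0).
  rewrite (uniform_const mtV (fun _ => tail_ge0 _ _) (c := 1%E)); last first.
    by move=> v /powV_bounds/andP[+ _]; exact: tail1.
  rewrite (uniform_const mt (fun _ => tail_ge0 _ _) (c := 1%E)); last first.
    by move=> v /andP[+ _]; exact: tail1.
  rewrite (uniform_const mI I0 (c := 1%E)); first by rewrite !mule1 -EFinD addrC subrK.
  move=> u /andP[u0 _]; apply: uniform_const => // v /powV_bounds/andP[v0 _].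
  by apply: tail1; rewrite mulr_gt0.
have [x1|x1] := leP 1 x.
  have tail0 y : y < 1 -> tail x y = 0%E.
    by move=> y1; rewrite /tail ltNge (le_trans (ltW y1) x1).
  rewrite (uniform_const mtV (fun _ => tail_ge0 _ _) (c := 0%E)); last first.
    by move=> v /powV_bounds/andP[_ +]; exact: tail0.
  rewrite (uniform_const mt (fun _ => tail_ge0 _ _) (c := 0%E)); last first.
    by move=> v /andP[_ +]; exact: tail0.
  rewrite (uniform_const mI I0 (c := 0%E)); first by rewrite !mule0 adde0.
  move=> u /andP[u0 u1]; apply: uniform_const => // v /powV_bounds/andP[v0 v1].
  by apply: tail0; rewrite mulr_ilt1// ltW.
have x01 : 0 <= x <= 1 by rewrite !ltW.
rewrite uniform_pow_tail// uniform_tail//.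
have -> : (\int[unif]_u \int[unif]_v tail x (u * v `^ rho^-1)%R =
    (1 - x - (x `^ rho - x) / (1 - rho))%:E)%E.
  rewrite integral_uniform01//.
  have -> : `]0%R, 1%R[%classic = `]0, x]%classic `|` `]x, 1[%classic :> set R.
    apply/seteqP; split => u /=; rewrite !in_itv/=.
      by case: (leP u x) => _ /andP[u0 u1]; [left|right]; rewrite ?u0.
    by case=> /andP[u0 u1]; apply/andP; split => //; [exact: le_lt_trans
        x1|exact: lt_trans u0].
  rewrite ge0_integral_setU//; last 2 first.
  - exact: measurable_funTS mI.
  - by apply/disj_setPS => u [] /=; rewrite !in_itv/= => /andP[_ ux] /andP[];
      rewrite ltNge ux.
  (* For u <= x the product u V^(1/rho) does not exceed x. *)
  rewrite integral0_eq ?add0e; last first.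
    move=> u /=; rewrite in_itv/= => /andP[u0 ux].
    apply: uniform_const => // v /powV_bounds/andP[v0 v1].
    rewrite /tail ltNge (le_trans _ ux)//.
    by rewrite ler_piMr// ltW.
  rewrite -integral_tail_pow ?x0// [RHS]integral_itv_bndoo; last first.
    apply: measurable_funTS; apply/measurable_EFinP; apply: measurable_funB => //.
    by apply: measurable_funM => //; exact: measurable_powR.
  apply: eq_integral => u; rewrite inE/= in_itv/= => /andP[xu u1].
  have u0 : 0 < u by exact: lt_trans xu.
  transitivity (\int[unif]_v tail (x / u) (v `^ rho^-1))%E.
    by apply: eq_integral => v _; rewrite /tail ltr_pdivrMr// mulrC.
  rewrite uniform_pow_tail; last by rewrite ler_pdivrMr// mul1r divr_ge0 ?ltW.
  congr (_ - _)%:E; rewrite powRM ?invr_ge0 ?ltW//; congr (_ * _).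
  by rewrite -powR_inv1 ?ltW// -powRrM mulN1r.
rewrite -!EFinM -EFinD; congr EFin; field.
by rewrite gt_eqF// subr_gt0.
Qed.

Let law_ray d (T : measurableType d) (m : probability T R) (X : T -> R) x :
  measurable_fun setT X ->
  m (X @^-1` `]x, +oo[%classic) = (\int[m]_w tail x (X w))%E.
Proof.
move=> mX.
have mA : measurable (X @^-1` `]x, +oo[%classic).
  by rewrite -[_ @^-1` _]setTI; exact: mX.
transitivity (\int[m]_w (\1_(X @^-1` `]x, +oo[%classic) w)%:E)%E.
  by rewrite integral_indic// setIT.
apply: eq_integral => w _; rewrite /tail indicE; case: ifPn => xX.
  by rewrite mem_set//= in_itv/= xX.
by rewrite memNset//= in_itv/= andbT; exact/negP.
Qed.


(** Both sides are laws with equal tails. Iterated, the identity presents V^(1/rho) as a product of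
    a geometric number of independent uniforms: its negative logarithm is exponential of rate rho, a
    geometric sum of exponentials of rate 1. *)
Lemma geometric_power_integral (g : R -> \bar R) :
  measurable_fun setT g -> (forall x, 0 <= g x)%E ->
  (\int[unif]_v g (v `^ rho^-1)%R = rho%:E * \int[unif]_u g u +
   (1 - rho)%:E * \int[unif]_u \int[unif]_v g (u * v `^ rho^-1)%R)%E.
Proof.
move=> mg g0; rewrite -Q_integral//.
have pV := isMeasurableFun.Build _ _ _ _ _ measurable_Vpow.
have pZ := isMeasurableFun.Build _ _ _ _ _ mZ.
pose V' : {mfun R >-> R} := HB.pack (fun v : R => v `^ rho^-1) pV.
pose Z' : {mfun (bool * R * R)%type >-> R} := HB.pack Z pZ.
apply: eq_law_integral => //.
apply: (@measure_ray_ext R (distribution unif V') (distribution Q Z')).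
  by rewrite (le_lt_trans (probability_le1 _ _)) ?ltry.
move=> x; apply: etrans (law_ray unif x measurable_Vpow) _.
by apply: etrans (tail_mixture x) _; exact: esym (law_ray Q x mZ).
Qed.

End power_law.

(** * Uniqueness for contracting affine recursions *)

Section affine_recursion.
Local Open Scope ereal_scope.
Context d (W : measurableType d) (R : realType) (p : probability W R).
Context (a b : W -> R).
Hypotheses (ma : measurable_fun setT a) (mb : measurable_fun setT b).
Hypothesis a0 : forall w, (0 <= a w)%R.
Variable c : R.
Hypothesis Ea : \int[p]_w (a w)%:E <= c%:E.
Hypothesis c01 : (0 <= c < 1)%R.

Let c0 : (0 <= c)%R. Proof. by case/andP : c01. Qed.

Let step (g : R -> \bar R) (z : R) := \int[p]_w g (a w * z + b w)%R.

(** The class of test functions on which [step] contracts the constant [L]; the bound is additive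
    since values lie in [\bar R]. *)
Let good (L : R) (g : R -> \bar R) := [/\ measurable_fun setT g,
  (forall x, 0 <= g x <= 1) & (forall x y, g x <= g y + (L * `|x - y|)%:E)].

(** The images of [x] and [y] are a |x - y| apart, the shift [b] cancelling, so averaging yields the
    factor E a <= c. *)
Let step_good L g : (0 <= L)%R -> good L g -> good (L * c)%R (step g).
Proof.
move=> L0 [mg g01 gL].
have g0 x : 0 <= g x by case/andP : (g01 x).
have mgz z : measurable_fun setT (fun w => g (a w * z + b w)%R).
  apply: (measurableT_comp mg); apply: measurable_funD => //.
  exact: measurable_funM.
split.
- apply: measurable_integral_snd => //; apply: (measurableT_comp mg).
  apply: measurable_funD; last exact: (measurable_comp_snd R mb).
  by apply: measurable_funM => //; exact: (measurable_comp_snd R ma).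
- by move=> x; exact: integral_itv01.
move=> x y.
pose e := (L * `|x - y|)%R.
have e0 : (0 <= e)%R by rewrite mulr_ge0.
apply: (@le_trans _ _ (\int[p]_w (g (a w * y + b w)%R + e%:E * (a w)%:E))).
  apply: ge0_le_integral => //.
  - apply: emeasurable_funD => //; apply: measurable_funeM.
    exact/measurable_EFinP.
  - move=> w _; apply: le_trans (gL _ (a w * y + b w)%R) _.
    rewrite leeD2l// -EFinM lee_fin /e -mulrA ler_wpM2l//.
    rewrite (_ : (_ - _ = (x - y) * a w)%R); last by ring.
    by rewrite normrM (ger0_norm (a0 w)).
rewrite ge0_integralD//; last 2 first.
- by move=> w _; rewrite mule_ge0 ?lee_fin.
- by apply: measurable_funeM; exact/measurable_EFinP.
rewrite leeD2l// ge0_integralZl_EFin//; last 2 first.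
- by move=> w _; rewrite lee_fin.
- exact/measurable_EFinP.
rewrite (_ : (_ * _ * _)%R = (e * c)%R); last by rewrite /e; ring.
apply: le_trans (lee_wpmul2l _ Ea) _; last by rewrite -EFinM lexx.
by rewrite lee_fin.
Qed.

Let iter_good L g n : (0 <= L)%R -> good L g -> good (L * c ^+ n)%R (iter n step g).
Proof.
move=> L0 gL; elim: n => [|n IHn]; first by rewrite expr0 mulr1.
by rewrite iterS exprSr mulrA; apply: step_good => //; rewrite mulr_ge0// exprn_ge0.
Qed.

(** Applying the fixed-point equation [n] times replaces a test function of constant L by one of
    constant L c^n with the same integral under each law; in the limit nothing distinguishes the two
    laws. *)
Lemma affine_fixpoint_unique (mu nu : probability R R) :
  (forall f, measurable_fun setT f -> (forall x, 0 <= f x) ->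
    \int[mu]_x f x = \int[mu]_x \int[p]_w f (a w * x + b w)%R) ->
  (forall f, measurable_fun setT f -> (forall x, 0 <= f x) ->
    \int[nu]_x f x = \int[nu]_x \int[p]_w f (a w * x + b w)%R) ->
  forall A, measurable A -> mu A = nu A.
Proof.
move=> fixmu fixnu.
have fix_iter (m : probability R R) :
    (forall f, measurable_fun setT f -> (forall x, 0 <= f x) ->
      \int[m]_x f x = \int[m]_x \int[p]_w f (a w * x + b w)%R) ->
    forall L g n, (0 <= L)%R -> good L g -> \int[m]_x g x = \int[m]_x iter n step g x.
  move=> fm L g n L0 gL; elim: n => [//|n ->].
  have [mg g01 _] := iter_good n L0 gL.
  by rewrite fm// => x; case/andP : (g01 x).
have le_int (m m' : probability R R) L g :
    (forall n, \int[m]_x g x = \int[m]_x iter n step g x) ->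
    (forall n, \int[m']_x g x = \int[m']_x iter n step g x) ->
    (0 <= L)%R -> good L g -> \int[m]_x g x <= \int[m']_x g x.
  move=> fm fm' L0 gL.
  (* The cap 1, valid because test functions lie in [0, 1], permits bounded convergence even when |x
     - y| is not integrable. *)
  pose e n (x y : R) : \bar R := (Num.min 1 (L * c ^+ n * `|x - y|))%R%:E.
  have e01 n x y : 0 <= e n x y <= 1.
    rewrite /e !lee_fin le_min ler01 ge_min lexx/= !andbT.
    by rewrite !mulr_ge0// exprn_ge0.
  have e0 n x y : 0 <= e n x y by case/andP : (e01 n x y).
  have me n : measurable_fun setT (fun z : R * R => e n z.1 z.2).
    apply/measurable_EFinP; apply: measurable_minr => //.
    apply: measurable_funM => //; apply: measurableT_comp => //.
    exact: measurable_funB.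
  have le_n n : \int[m]_x g x <= \int[m']_y g y + \int[m]_x \int[m']_y e n x y.
    have [mg g01 gLn] := iter_good n L0 gL.
    rewrite (fm n) (fm' n); set h := iter n step g in mg g01 gLn *.
    have h0 x : 0 <= h x by case/andP : (g01 x).
    rewrite -(probability_integral_cst m (\int[m']_y h y)) -ge0_integralD//;
        last 3 first.
    - by move=> x _; exact: integral_ge0.
    - by move=> x _; exact: integral_ge0.
    - exact: measurable_integral_snd.
    apply: ge0_le_integral => //.
    - apply: emeasurable_funD => //; exact: measurable_integral_snd.
    - move=> x _; rewrite -ge0_integralD//; last first.
        exact: (measurableT_comp (me n) (pair1_measurable x)).
      rewrite -[leLHS](probability_integral_cst m'); apply: ge0_le_integral => //.
      + by apply: emeasurable_funD => //; exact: (measurableT_comp (me n)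
          (pair1_measurable x)).
      + move=> y _; rewrite /e EFin_min; have [_|_] := leP 1%E (L * c ^+ n *
          `|x - y|)%:E; last exact: gLn.
        by case/andP : (g01 x) => _ /le_trans; apply; rewrite leeDr.
  have m1 (m0 : probability R R) : m0 setT < +oo.
    by rewrite (le_lt_trans (probability_le1 _ _)) ?ltry.
  have cv : (\int[m]_x \int[m']_y e n x y) @[n --> \oo] --> 0.
    have -> : 0 = \int[m]_x \int[m']_y (0 : \bar R).
      by rewrite integral0_eq// => x _; rewrite integral0.
    apply: (@bounded_cvg _ _ R m setT (fun n x => \int[m']_y e n x y) (fun=>
        \int[m']_y 0)) => //.
    - exact: m1.
    - by move=> n; exact: measurable_integral_snd.
    - by move=> n x _; apply: integral_itv01 => //; exact: (measurableT_comp
        (me n) (pair1_measurable x)).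
    move=> x _; apply: (@bounded_cvg _ _ R m' setT (fun n y => e n x y) (fun=>
        0)) => //.
    - exact: m1.
    - by move=> n; exact: (measurableT_comp (me n) (pair1_measurable x)).
    move=> y _; apply: cvg_EFin; first exact: nearW.
    have : (L * c ^+ n * `|x - y|)%R @[n --> \oo] --> (L * 0 * `|x - y|)%R.
      apply: cvgMl; apply: cvgMr; apply: cvg_expr.
      by rewrite ger0_norm//; case/andP : c01.
    rewrite mulr0 mul0r => cv0.
    apply: (@squeeze_cvgr _ _ _ _ (fun=> 0%R) (fun n => L * c ^+ n * `|x -
        y|)%R) => //; last exact: cvg_cst.
    by apply: nearW => n; rewrite ge_min lexx orbT andbT -lee_fin; exact: e0.
  have gfin : \int[m']_y g y \is a fin_num.
    have [mg g01 _] := gL.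
    have /andP[h0 h1] := integral_itv01 m' mg g01.
    by rewrite ge0_fin_numE// (le_lt_trans h1) ?ltry.
  rewrite -[leRHS]adde0.
  have cvD : (\int[m']_y g y + \int[m]_x \int[m']_y e n x y) @[n --> \oo] -->
      \int[m']_y g y + 0.
    by apply: cvgeD => //; [exact: fin_num_adde_defr|exact: cvg_cst].
  apply: cvge_ge cvD; exact: nearW.
apply: lipschitz_law_ext => [||L f fL f01].
- by rewrite (le_lt_trans (probability_le1 _ _)) ?ltry.
- by rewrite (le_lt_trans (probability_le1 _ _)) ?ltry.
(* [lipschitz_le] does not state L >= 0, hence the absolute value. *)
have gf : good `|L|%R (EFin \o f).
  split.
  - apply/measurable_EFinP; apply: continuous_measurable_fun.
    exact: lipschitz_le_continuous fL.
  - by move=> x; rewrite /= !lee_fin.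
  - move=> x y; rewrite /= lee_fin (le_trans (fL x y))// lerD2l.
    by rewrite ler_wpM2r// ler_norm.
have L0 : (0 <= `|L|)%R by [].
apply/eqP; rewrite eq_le; apply/andP; split.
- exact: (le_int mu nu _ _ (fun n => fix_iter mu fixmu _ _ n L0 gf)
    (fun n => fix_iter nu fixnu _ _ n L0 gf) L0 gf).
- exact: (le_int nu mu _ _ (fun n => fix_iter nu fixnu _ _ n L0 gf)
    (fun n => fix_iter mu fixmu _ _ n L0 gf) L0 gf).
Qed.


End affine_recursion.

(** * The perpetuity operator *)

Section perpetuity_operator.
Context {R : realType} (beta rho : R) (s : probability R R).
Local Notation unif := (uniform01 R).
Local Open Scope ereal_scope.

(** One step from the value [z], with U and S averaged out: [perp_add] is the case of a positive
    increment, [perp_scale] that of a vanishing one. *)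
Definition perp_add (g : R -> \bar R) (z : R) :=
  \int[s]_x \int[unif]_u g (u `^ beta * z + (1 - u) `^ beta * x)%R.

Definition perp_scale (f : R -> \bar R) (z : R) :=
  \int[unif]_u f (u `^ beta * z)%R.

(** Multiplication by Lambda^beta on the event B = 1. *)
Definition perp_powscale (f : R -> \bar R) (z : R) :=
  \int[unif]_v f ((v `^ rho^-1) `^ beta * z)%R.

Lemma measurable_perp_add g : measurable_fun setT g -> (forall x, 0 <= g x) ->
  measurable_fun setT (perp_add g).
Proof.
move=> mg g0.
pose h (z x u : R) := g (u `^ beta * z + (1 - u) `^ beta * x)%R.
have mh : measurable_fun setT (fun t : R * R * R => h t.1.1 t.1.2 t.2).
  have m1 : measurable_fun setT (fun t : R * R * R => t.1.1).
    exact: (measurable_comp_fst R measurable_fst).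
  have m2 : measurable_fun setT (fun t : R * R * R => t.1.2).
    exact: (measurable_comp_fst R measurable_snd).
  have m3 : measurable_fun setT (fun t : R * R * R => t.2) by exact: measurable_snd.
  apply: (measurableT_comp mg); apply: measurable_funD; apply: measurable_funM => //.
    exact: (measurableT_comp (measurable_powR beta) m3).
  apply: (measurableT_comp (measurable_powR beta)); exact: measurable_funB.
apply: measurable_integral_snd; last by move=> *; apply: integral_ge0 => u _; exact: g0.
apply: (@measurable_integral_snd _ _ (R * R)%type R R unif (fun t u => h t.1
    t.2 u)) => //.
by move=> *; exact: g0.
Qed.

Lemma measurable_perp_scale f : measurable_fun setT f -> (forall x, 0 <= f x) ->
  measurable_fun setT (perp_scale f).
Proof.
move=> mf f0; apply: measurable_integral_snd; last by move=> *; exact: f0.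
apply: (measurableT_comp mf); apply: measurable_funM => //.
exact: (measurable_comp_snd R (measurable_powR beta)).
Qed.

Lemma measurable_perp_powscale f : measurable_fun setT f -> (forall x, 0 <= f x) ->
  measurable_fun setT (perp_powscale f).
Proof.
move=> mf f0; apply: measurable_integral_snd; last by move=> *; exact: f0.
apply: (measurableT_comp mf); apply: measurable_funM => //.
apply: (measurableT_comp (measurable_powR beta)).
exact: (measurable_comp_snd R (measurable_powR rho^-1)).
Qed.

(* In law, [V^(1/rho)] is [U] with probability [rho] and an independent product
   [U * V^(1/rho)] otherwise. *)
Lemma perp_powscaleE f z : (0 < rho < 1)%R -> measurable_fun setT f ->
  (forall x, 0 <= f x) ->
  perp_powscale f z =
  rho%:E * perp_scale f z + (1 - rho)%:E * perp_scale (perp_powscale f) z.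
Proof.
move=> rho01 mf f0.
pose g (y : R) := f (y `^ beta * z)%R.
have mg : measurable_fun setT g.
  apply: (measurableT_comp mf); apply: measurable_funM => //.
have g0 x : 0 <= g x by exact: f0.
apply: etrans (geometric_power_integral rho01 mg g0) _.
congr (_ + _ * _).
rewrite integral_uniform01; last 2 first.
- apply: measurable_integral_snd => //; apply: (measurableT_comp mg).
  by apply: measurable_funM => //; exact: (measurable_comp_snd R
      (measurable_powR rho^-1)).
- by move=> u; apply: integral_ge0 => v _; exact: g0.
apply: esym; apply: etrans (integral_uniform01 _ _) _.
- apply: (measurableT_comp (measurable_perp_powscale mf f0)).
  by apply: measurable_funM => //; exact: (measurable_powR beta).
- by move=> u; apply: integral_ge0 => v _; exact: f0.
apply: eq_integral => u; rewrite inE/= in_itv/= => /andP[u0 _].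
apply: eq_integral => v _; congr f.
by rewrite powRM ?powR_ge0 ?ltW//; ring.
Qed.

End perpetuity_operator.

(** * The law of a variable conditioned on being positive *)

Section conditional_law.
Context d (T : measurableType d) (R : realType) (P : probability T R).
Context (X : {RV P >-> R}) (r : R).
Hypotheses (r01 : 0 < r < 1) (Xr : P [set w | 0 < X w] = r%:E).

Let r0 : 0 < r. Proof. by case/andP : r01. Qed.
Let pos := [set w | 0 < X w].

Let mpos : measurable pos.
Proof.
rewrite (_ : pos = X @^-1` `]0, +oo[%classic); first exact: measurable_funPTI.
by apply/seteqP; split => w /=; rewrite in_itv/= andbT.
Qed.

(** [cond_law] is a bare set function; restricting P to the event and dividing by its mass gives a
    probability to integrate against. *)
Lemma cond_law_probability : exists s : probability R R,
  forall A, measurable A -> s A = cond_law P X pos A.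
Proof.
have rV0 : 0 <= r^-1 by rewrite invr_ge0 ltW.
pose m : {measure set T -> \bar R} := mscale (NngNum rV0) (mrestr P mpos).
have m1 : m setT = 1%E.
  by rewrite /m/= /mscale/= /mrestr setTI Xr -EFinM mulVf ?gt_eqF.
pose p : probability T R := HB.pack (Measure.sort m)
  (Measure_isProbability.Build _ _ _ m m1).
exists (distribution p X) => A mA.
rewrite /cond_law Xr /distribution /pushforward /= /mscale/= /mrestr muleC.
by rewrite inver gt_eqF.
Qed.

(** The law of X^+ is r s + (1 - r) delta_0, the atom collecting the event X <= 0. *)
Lemma posp_integral (s : probability R R) (g : R -> \bar R) :
  (forall A, measurable A -> s A = cond_law P X pos A) ->
  measurable_fun setT g -> (forall x, 0 <= g x)%E ->
  (\int[P]_w g (posp (X w)) = r%:E * \int[s]_x g x + (1 - r)%:E * g 0%R)%E.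
Proof.
move=> sE mg g0.
have r1 : 0 <= 1 - r by rewrite subr_ge0 ltW//; case/andP : r01.
pose m : {measure set R -> \bar R} := measure_add (mscale (NngNum (ltW r0)) s)
  (mscale (NngNum r1) \d_(0 : R)).
transitivity (\int[m]_x g x)%E; last first.
  rewrite ge0_integral_measure_add// !ge0_integral_mscale//=.
  by rewrite integral_dirac// diracT mul1e.
apply: (@eq_law_integral _ _ _ R R T R P m (fun w => posp (X w)) idfun) => //.
- exact: measurable_posp.
- exact: measurable_id.
move=> A mA.
rewrite -[RHS]/(measure_add (mscale (NngNum (ltW r0)) s)
  (mscale (NngNum r1) \d_(0 : R)) A).
rewrite measure_addE/= /mscale/= sE// /cond_law Xr.
have mX : measurable (X @^-1` A `&` pos) by apply: measurableI => //; exact: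
    measurable_funPTI.
rewrite inver gt_eqF// muleCA -EFinM mulfV ?gt_eqF// mule1.
have -> : (fun w => posp (X w)) @^-1` A = (X @^-1` A `&` pos) `|` (~` pos `&`
    [set _ | A 0]).
  apply/seteqP; split => w; rewrite /= /pos/= /posp.
    by have [x0|x0] := ltP 0 (X w) => Aw; [left|right]; split => //;
        apply/negP; rewrite -leNgt.
  by case=> [[Aw /ltW /max_r ->]//|[/negP]]; rewrite -leNgt => /max_l ->.
have PC : P (~` pos) = (1 - r)%:E.
  by rewrite probability_setC// Xr.
have [A0|A0] := pselect (A 0).
  rewrite (_ : [set _ | A 0] = setT); last by apply/seteqP; split.
  rewrite setIT measureU//; last 2 first.
  - exact: measurableC.
  - by rewrite -setIA setICr setI0.
  by rewrite diracE mem_set// mule1; congr (_ + _)%E.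
rewrite (_ : [set _ | A 0] = set0); last by apply/seteqP; split.
by rewrite setI0 setU0 diracE memNset// mule0 adde0.
Qed.

End conditional_law.

Section sup_law.
Context d (T : measurableType d) (R : realType) (P : probability T R).
Context (alpha rho : R) (Y : R -> {RV P >-> R}).
Hypothesis SY : stable_process alpha rho Y.

Let beta := alpha^-1.
Local Notation unif := (uniform01 R).
Local Open Scope ereal_scope.

Let mS : measurable_fun setT (sup01 Y) := measurable_sup01 SY.

Let Z (z : T * T * R) : R :=
  (z.2 `^ beta * sup01 Y z.1.1 + (1 - z.2) `^ beta * posp (Y 1%R z.1.2))%R.

Let mZ : measurable_fun setT Z.
Proof.
apply: measurable_funD; apply: measurable_funM.
- exact: (measurable_comp_snd (T * T)%type (measurable_powR beta)).
- exact: (measurable_comp_fst R (measurable_comp_fst T mS)).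
- apply: (measurableT_comp (measurable_powR beta)).
  by apply: measurable_funB => //; exact: measurable_snd.
- exact: (measurable_comp_fst R (measurable_comp_snd T (measurable_posp
    (measurable_funP (Y 1%R))))).
Qed.

Let PP : probability (T * T)%type R := P \x P.
Let Q : probability (T * T * R)%type R := PP \x unif.

Let Q_integral (g : R -> \bar R) : measurable_fun setT g -> (forall x, 0 <= g x) ->
  \int[Q]_z g (Z z) = \int[P]_w \int[P]_w' \int[unif]_u g (Z (w, w', u)).
Proof.
move=> mg g0; have mgZ := measurableT_comp mg mZ.
apply: etrans (@fubini_tonelli1 _ _ _ _ _ PP unif _ mgZ (fun z => g0 _)) _.
apply: etrans (@fubini_tonelli1 _ _ _ _ _ P P _ _ _) _ => //.
- exact: (@measurable_fun_fubini_tonelli_F _ _ _ _ _ unif _ mgZ (fun z => g0 _)).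
- by move=> z; apply: integral_ge0 => u _; exact: g0.
Qed.

(** Extension of [sup01_equation] beyond continuous functions: once the right-hand side is a
    variable [Z] on a product space, both sides are laws, determined by Lipschitz functions. The
    uniform variable moves innermost, as in [perp_add]. *)
Lemma sup01_law (g : R -> \bar R) : measurable_fun setT g -> (forall x, 0 <= g x) ->
  \int[P]_w g (sup01 Y w) = \int[P]_w \int[P]_w' \int[unif]_u
    g (u `^ beta * sup01 Y w + (1 - u) `^ beta * posp (Y 1%R w'))%R.
Proof.
move=> mg g0; apply: etrans _ (Q_integral mg g0).
have pS := isMeasurableFun.Build _ _ _ _ _ mS.
have pZ := isMeasurableFun.Build _ _ _ _ _ mZ.
pose S' : {mfun T >-> R} := HB.pack (sup01 Y) pS.
pose Z' : {mfun (T * T * R)%type >-> R} := HB.pack Z pZ.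
apply: eq_law_integral => //.
apply: (@lipschitz_law_ext R (distribution P S') (distribution Q Z')).
- by rewrite (le_lt_trans (probability_le1 _ _)) ?ltry.
- by rewrite (le_lt_trans (probability_le1 _ _)) ?ltry.
move=> L f fL f01; have cf := lipschitz_le_continuous fL.
have mf : measurable_fun setT (EFin \o f).
  by apply/measurable_EFinP; exact: continuous_measurable_fun.
have f0 x : 0 <= (EFin \o f) x by rewrite lee_fin; case/andP : (f01 x).
apply: etrans (ge0_integral_distribution S' mf f0) _.
apply: etrans _ (esym (ge0_integral_distribution Z' mf f0)).
apply: etrans (sup01_equation SY cf f01) _.
apply: etrans _ (esym (Q_integral mf f0)).
pose h (u : R) (t : T * T) := (f (Z (t.1, t.2, u)))%:E.
have mfZ := measurableT_comp mf mZ.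
have h0 u t : 0 <= h u t by exact: f0.
pose swap (z : R * (T * T)) : T * T * R := (z.2.1, z.2.2, z.1).
have mswap : measurable_fun setT swap.
  apply: measurable_fun_pair; last exact: measurable_fst.
  apply: measurable_fun_pair.
    exact: (measurable_comp_snd R measurable_fst).
  exact: (measurable_comp_snd R measurable_snd).
have mh : measurable_fun setT (fun z : R * (T * T) => h z.1 z.2).
  exact: (measurableT_comp mfZ mswap).
have mhu u : measurable_fun setT (h u).
  exact: (measurableT_comp mh (pair1_measurable u)).
have mht t : measurable_fun setT (h ^~ t).
  exact: (measurableT_comp mh (pair2_measurable t)).
transitivity (\int[unif]_u \int[PP]_t h u t).
  apply: eq_integral => u _.
  exact: esym (@fubini_tonelli1 _ _ _ _ _ P P _ (mhu u) (h0 u)).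
apply: etrans (ge0_integral_swap unif PP mh h0) _.
apply: etrans (@fubini_tonelli1 _ _ _ _ _ P P _ _ _) _ => //.
- apply: (@measurable_integral_snd _ _ (T * T)%type R R unif (fun t u => h u t)) => //.
- by move=> t; exact: integral_ge0.
Qed.

End sup_law.

(** * Absorbing the vanishing increments *)

Section sup_fixed_point.
Context d (T : measurableType d) (R : realType) (P : probability T R).
Context (alpha rho : R) (Y : R -> {RV P >-> R}).
Hypotheses (rho01 : 0 < rho < 1) (SY : stable_process alpha rho Y).
Context (s : probability R R).
Hypothesis sE : forall A, measurable A ->
  s A = cond_law P (Y 1) [set w | 0 < Y 1 w] A.

Let beta := alpha^-1.
Local Notation unif := (uniform01 R).
Local Open Scope ereal_scope.

Let mS : measurable_fun setT (sup01 Y) := measurable_sup01 SY.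
Let rho0 : (0 < rho)%R. Proof. by case/andP : rho01. Qed.
Let rho1 : (0 <= 1 - rho)%R. Proof. by rewrite subr_ge0 ltW//; case/andP : rho01. Qed.

Let mu (g : R -> \bar R) := \int[P]_w g (sup01 Y w).

Let muD (g1 g2 : R -> \bar R) (a b : R) : (0 <= a)%R -> (0 <= b)%R ->
  measurable_fun setT g1 -> measurable_fun setT g2 ->
  (forall x, 0 <= g1 x) -> (forall x, 0 <= g2 x) ->
  mu (fun x => a%:E * g1 x + b%:E * g2 x) = a%:E * mu g1 + b%:E * mu g2.
Proof.
move=> a0 b0 mg1 mg2 g10 g20.
have m1 := measurableT_comp mg1 mS.
have m2 := measurableT_comp mg2 mS.
rewrite /mu ge0_integralD//; last 4 first.
- by move=> w _; rewrite mule_ge0.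
- exact: measurable_funeM.
- by move=> w _; rewrite mule_ge0.
- exact: measurable_funeM.
by rewrite !ge0_integralZl_EFin.
Qed.

(** Averaging over Y_1^+, which is S with probability rho and 0 otherwise; in the second case only
    the scaling by U^beta remains. *)
Let sup01_split g : measurable_fun setT g -> (forall x, 0 <= g x) ->
  mu g = rho%:E * mu (perp_add beta s g) + (1 - rho)%:E * mu (perp_scale beta g).
Proof.
move=> mg g0.
rewrite -muD//; last 5 first.
- exact: ltW.
- exact: measurable_perp_add.
- exact: measurable_perp_scale.
- by move=> x; apply: integral_ge0 => y _; exact: integral_ge0.
- by move=> x; exact: integral_ge0.
apply: etrans (sup01_law SY mg g0) _; apply: eq_integral => w _.
pose h y := \int[unif]_u g (u `^ beta * sup01 Y w + (1 - u) `^ beta * y)%R.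
have h0 y : 0 <= h y by exact: integral_ge0.
have mh : measurable_fun setT h.
  apply: measurable_integral_snd => //; apply: (measurableT_comp mg).
  apply: measurable_funD; apply: measurable_funM => //.
    exact: (measurable_comp_snd R (measurable_powR beta)).
  apply: (measurableT_comp (measurable_powR beta)).
  by apply: measurable_funB => //; exact: measurable_snd.
apply: etrans (posp_integral rho01 (stable_positivity SY) sE mh h0) _.
congr (_ + _ * _); apply: eq_integral => u _.
by rewrite mulr0 addr0.
Qed.

(** The perpetuity step averaged over B, U, V, S: Lambda is 1 with probability rho and V^(1/rho)
    otherwise, and this mixture is the inner function. *)
Definition perp_op (f : R -> \bar R) :=
  perp_add beta s (fun x => rho%:E * f x + (1 - rho)%:E * perp_powscale beta rho f x).

(** The splitting is applied to the mixture [C] instead of [f], because scaling [C] by U^beta gives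
    back [K]; the two occurrences of (1 - rho) m(K), with m the expectation at the supremum, then
    cancel. *)
Lemma sup01_fixed f : measurable_fun setT f -> (forall x, 0 <= f x <= 1) ->
  \int[P]_w f (sup01 Y w) = \int[P]_w perp_op f (sup01 Y w).
Proof.
move=> mf f01.
have f0 x : 0 <= f x by case/andP : (f01 x).
pose K := perp_powscale beta rho f.
have K0 x : 0 <= K x by exact: integral_ge0.
have mK : measurable_fun setT K by exact: measurable_perp_powscale.
pose C x := rho%:E * f x + (1 - rho)%:E * K x.
have C0 x : 0 <= C x by rewrite adde_ge0// mule_ge0// lee_fin ltW.
have mC : measurable_fun setT C.
  by apply: emeasurable_funD; exact: measurable_funeM.
have DC : perp_scale beta C = K.
  apply/funext => z; rewrite /K (perp_powscaleE _ _ rho01 mf f0) -/K.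
  have mpow (h : R -> \bar R) : measurable_fun setT h ->
      measurable_fun setT (fun u => h (u `^ beta * z)%R).
    move=> mh; apply: (measurableT_comp mh); apply: measurable_funM => //.
  rewrite /perp_scale /C ge0_integralD//; last 4 first.
  - by move=> u _; rewrite mule_ge0// lee_fin ltW.
  - by apply: measurable_funeM; exact: (mpow f).
  - by move=> u _; rewrite mule_ge0.
  - by apply: measurable_funeM; exact: (mpow K).
  rewrite !ge0_integralZl_EFin//.
  - exact: (mpow K).
  - exact: (mpow f).
  - exact: ltW.
have := sup01_split mC C0; rewrite DC.
rewrite {1}/C muD//; last exact: ltW.
(* In [\bar R] only a finite term can be cancelled; this is where f <= 1 is needed. *)
have fin_mu (g : R -> \bar R) : measurable_fun setT g -> (forall x, 0 <= g x <=
    1) -> mu g \is a fin_num.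
  move=> mg g01.
  have /andP[h0 h1] : 0 <= mu g <= 1.
    by apply: integral_itv01 => //; exact: measurableT_comp mg mS.
  by rewrite ge0_fin_numE// (le_lt_trans h1) ?ltry.
have K01 x : 0 <= K x <= 1.
  apply: integral_itv01 => //; apply: (measurableT_comp mf).
  apply: measurable_funM => //; apply: (measurableT_comp (measurable_powR beta)).
  exact: (measurable_powR rho^-1).
have muK := fin_mu K mK K01.
have cK : (1 - rho)%:E * mu K \is a fin_num by rewrite fin_numM.
move/(congr1 (fun y => y - (1 - rho)%:E * mu K)); rewrite !addeK//.
move/(congr1 (fun y => rho^-1%:E * y)).
by rewrite !muleA -EFinM mulVf ?gt_eqF// !mul1e.
Qed.

End sup_fixed_point.

(** * Integrating out B, U, V and S *)

Section perpetuity_integral.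
Context d (T : measurableType d) (R : realType) (Q : probability T R).
Context (alpha rho : R) (s : probability R R).
Hypothesis rho01 : 0 < rho < 1.
Context (B U V S zeta : {RV Q >-> R}).
Hypothesis indepX : independent Q
  (tnth [tuple (B : T -> R); (U : T -> R); (V : T -> R); (S : T -> R); (zeta :
      T -> R)]).
Hypotheses (QB1 : Q [set w | B w = 1] = (1 - rho)%:E)
  (QB0 : Q [set w | B w = 0] = rho%:E).
Hypotheses (lawU : eq_law (pushforward Q U) (uniform_prob (@ltr01 R)))
  (lawV : eq_law (pushforward Q V) (uniform_prob (@ltr01 R)))
  (lawS : eq_law (pushforward Q S) s).

Local Notation unif := (uniform01 R).
Local Open Scope ereal_scope.
Let beta := (alpha^-1)%R.

(** The two atoms have total mass 1, so the rest of the space is negligible. *)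
Let bernoulli_integral (h : R -> \bar R) : measurable_fun setT h ->
  (forall x, 0 <= h x) ->
  \int[Q]_w h (B w) = (1 - rho)%:E * h 1%R + rho%:E * h 0%R.
Proof.
move=> mh h0; have mhB := measurableT_comp mh (measurable_funP B).
pose E1 := [set w | B w = 1%R]; pose E0 := [set w | B w = 0%R].
have mE1 : measurable E1 := measurable_funPTI B (measurable_set1 1%R).
have mE0 : measurable E0 := measurable_funPTI B (measurable_set1 0%R).
have mE := measurableU _ _ mE1 mE0.
have E10 : E1 `&` E0 = set0.
  apply/seteqP; split => w //= -[Bw1 Bw0].
  by have := oner_neq0 R; rewrite -[X in X != _](etrans (esym Bw0) Bw1) eqxx.
have QE : Q (E1 `|` E0) = 1.
  transitivity (Q E1 + Q E0); first exact: measureU.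
  transitivity ((1 - rho)%:E + rho%:E).
    by congr (_ + _); [exact: QB1|exact: QB0].
  by rewrite -EFinD subrK.
rewrite -(setvU (E1 `|` E0)) ge0_integral_setU//; last 2 first.
- exact: measurableC.
- by rewrite disj_set2E setICl.
rewrite null_set_integral ?add0e; last 3 first.
- exact: measurableC.
- exact: measurable_funTS.
- apply: etrans (probability_setC Q mE) _; rewrite QE subee//.
rewrite ge0_integral_setU//; last by rewrite disj_set2E E10 eqxx.
congr (_ + _).
- transitivity (\int[Q]_(w in E1) h 1%R).
    by apply: eq_integral => w /set_mem Bw; congr h; exact: Bw.
  by rewrite integral_cst// muleC; congr (_ * _); exact: QB1.
- transitivity (\int[Q]_(w in E0) h 0%R).
    by apply: eq_integral => w /set_mem Bw; congr h; exact: Bw.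
  by rewrite integral_cst// muleC; congr (_ * _); exact: QB0.
Qed.

Let uniform_integral (W : {RV Q >-> R}) (h : R -> \bar R) :
  eq_law (pushforward Q W) (uniform_prob (@ltr01 R)) -> measurable_fun setT h ->
  (forall x, 0 <= h x) -> \int[Q]_w h (W w) = \int[unif]_u h u.
Proof.
move=> lawW mh h0.
apply: (@eq_law_integral _ _ _ R R T R Q unif W idfun h) => //.
exact: measurable_id.
Qed.

Let integral_mix (h : R -> \bar R) (c : \bar R) : measurable_fun setT h ->
  (forall x, 0 <= h x) -> 0 <= c ->
  \int[unif]_v ((1 - rho)%:E * h v + rho%:E * c) =
  rho%:E * c + (1 - rho)%:E * \int[unif]_v h v.
Proof.
move=> mh h0 c0.
have rho0 : (0 <= rho)%R by case/andP : rho01 => /ltW.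
have rho1 : (0 <= 1 - rho)%R by rewrite subr_ge0; case/andP : rho01 => _ /ltW.
rewrite ge0_integralD//; last 3 first.
- by move=> v _; rewrite mule_ge0.
- exact: measurable_funeM.
- by move=> v _; rewrite mule_ge0.
by rewrite ge0_integralZl_EFin// addeC probability_integral_cst.
Qed.

Lemma perp_integral (f : R -> \bar R) : measurable_fun setT f ->
  (forall x, 0 <= f x) ->
  \int[Q]_w f (perpetuity_map alpha rho (B w) (U w) (V w) (S w) (zeta w)) =
  \int[Q]_w perp_op alpha rho s f (zeta w).
Proof.
move=> mf f0.
pose tup := [tuple (B : T -> R); (U : T -> R); (V : T -> R); (S : T -> R);
    (zeta : T -> R)].
(* Reversal puts [zeta] first and [B] last: the tuple grows from [zeta], and its newest entry is the
   one integrated out. *)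
have iX := independent_rev (indepX : independent Q (tnth tup)).
pose X (i : 'I_5) := tnth tup (rev_ord i).
have mtup i : measurable_fun setT (tnth tup i).
  by case: i => -[|[|[|[|[|//]]]]] i5; rewrite (tnth_nth (B : T -> R))/=.
have mX i : measurable_fun setT (X i) by exact: mtup.
pose o k (k5 : (k < 5)%N) : 'I_5 := Ordinal k5.
have X0 : X (@o 0%N isT) = zeta by rewrite /X (tnth_nth (B : T -> R)).
have X1 : X (@o 1%N isT) = S by rewrite /X (tnth_nth (B : T -> R)).
have X2 : X (@o 2%N isT) = V by rewrite /X (tnth_nth (B : T -> R)).
have X3 : X (@o 3%N isT) = U by rewrite /X (tnth_nth (B : T -> R)).
have X4 : X (@o 4%N isT) = B by rewrite /X (tnth_nth (B : T -> R)).
have i1 : indep_tail Q X 1 (zeta : T -> R).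
  have := indep_tailS (k := @o 0%N isT) (measurable_cst tt) mX (indep_tail_cst tt iX).
  rewrite X0 => i1; exact: (indep_tail_comp (measurable_snd : measurable_fun
      setT (snd : unit * R -> R)) i1).
have mz : measurable_fun setT (zeta : T -> R) by [].
have := indep_tailS (k := @o 1%N isT) mz mX i1.
have := @indep_tail_integral _ _ _ _ _ _ _ _ _ (@o 1%N isT) mz mX i1.
rewrite X1 => e2 i2; have mz2 := measurable_fun_pair mz (measurable_funP S).
have := indep_tailS (k := @o 2%N isT) mz2 mX i2.
have := @indep_tail_integral _ _ _ _ _ _ _ _ _ (@o 2%N isT) mz2 mX i2.
rewrite X2 => e3 i3; have mz3 := measurable_fun_pair mz2 (measurable_funP V).
have := indep_tailS (k := @o 3%N isT) mz3 mX i3.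
have := @indep_tail_integral _ _ _ _ _ _ _ _ _ (@o 3%N isT) mz3 mX i3.
rewrite X3 => e4 i4; have mz4 := measurable_fun_pair mz3 (measurable_funP U).
have := @indep_tail_integral _ _ _ _ _ _ _ _ _ (@o 4%N isT) mz4 mX i4.
rewrite X4 => e5.
pose F5 (p : R * R * R * R * R) : \bar R :=
  f (perpetuity_map alpha rho p.2 p.1.2 p.1.1.2 p.1.1.1.2 p.1.1.1.1).
have F50 p : 0 <= F5 p by exact: f0.
have mF5 : measurable_fun setT F5.
  have mb : measurable_fun setT (fun p : R * R * R * R * R => p.2) := measurable_snd.
  have mu : measurable_fun setT (fun p : R * R * R * R * R => p.1.2) :=
    measurable_comp_fst _ measurable_snd.
  have mv : measurable_fun setT (fun p : R * R * R * R * R => p.1.1.2) :=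
    measurable_comp_fst _ (measurable_comp_fst _ measurable_snd).
  have ms : measurable_fun setT (fun p : R * R * R * R * R => p.1.1.1.2) :=
    measurable_comp_fst _ (measurable_comp_fst _ (measurable_comp_fst _
        measurable_snd)).
  have mz' : measurable_fun setT (fun p : R * R * R * R * R => p.1.1.1.1) :=
    measurable_comp_fst _ (measurable_comp_fst _ (measurable_comp_fst _
        measurable_fst)).
  apply: (measurableT_comp mf); apply: measurable_funM.
    apply: (measurableT_comp (measurable_powR _)); apply: measurable_funD => //.
    apply: measurable_funM => //; apply: measurable_funB => //.
    exact: (measurableT_comp (measurable_powR _) mv).
  apply: measurable_funD; apply: measurable_funM => //.
    exact: (measurableT_comp (measurable_powR _) mu).
  by apply: (measurableT_comp (measurable_powR _)); exact: measurable_funB.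
pose F4 (p : R * R * R * R) := (1 - rho)%:E * F5 (p, 1%R) + rho%:E * F5 (p, 0%R).
have rho0 : (0 <= rho)%R by case/andP : rho01 => /ltW.
have rho1 : (0 <= 1 - rho)%R by rewrite subr_ge0; case/andP : rho01 => _ /ltW.
have F40 p : 0 <= F4 p by rewrite adde_ge0// mule_ge0// lee_fin.
have mF4 : measurable_fun setT F4.
  apply: emeasurable_funD; apply: measurable_funeM;
  exact: (measurableT_comp mF5 (pair2_measurable _)).
pose F3 (p : R * R * R) := \int[unif]_u F4 (p, u).
have F30 p : 0 <= F3 p by exact: integral_ge0.
have mF3 : measurable_fun setT F3 := @measurable_fun_fubini_tonelli_F _ _ _ _ _
    unif _ mF4 F40.
pose F2 (p : R * R) := \int[unif]_v F3 (p, v).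
have F20 p : 0 <= F2 p by exact: integral_ge0.
have mF2 : measurable_fun setT F2 := @measurable_fun_fubini_tonelli_F _ _ _ _ _
    unif _ mF3 F30.
pose F1 (z : R) := \int[s]_x F2 (z, x).
have step5 : \int[Q]_w F5 (zeta w, S w, V w, U w, B w) =
    \int[Q]_w F4 (zeta w, S w, V w, U w).
  apply: etrans (e5 F5 mF5 F50) _; apply: eq_integral => w _.
  apply: (bernoulli_integral (h := fun b => F5 (zeta w, S w, V w, U w, b))) => //.
  exact: (measurableT_comp mF5 (pair1_measurable _)).
have step4 : \int[Q]_w F4 (zeta w, S w, V w, U w) = \int[Q]_w F3 (zeta w, S w, V w).
  apply: etrans (e4 F4 mF4 F40) _; apply: eq_integral => w _.
  apply: (uniform_integral (h := fun u => F4 (zeta w, S w, V w, u)) lawU) => //.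
  exact: (measurableT_comp mF4 (pair1_measurable _)).
have step3 : \int[Q]_w F3 (zeta w, S w, V w) = \int[Q]_w F2 (zeta w, S w).
  apply: etrans (e3 F3 mF3 F30) _; apply: eq_integral => w _.
  apply: (uniform_integral (h := fun v => F3 (zeta w, S w, v)) lawV) => //.
  exact: (measurableT_comp mF3 (pair1_measurable _)).
have step2 : \int[Q]_w F2 (zeta w, S w) = \int[Q]_w F1 (zeta w).
  apply: etrans (e2 F2 mF2 F20) _; apply: eq_integral => w _.
  apply: (@eq_law_integral _ _ _ R R T R Q s S idfun (fun x => F2 (zeta w, x))).
  - exact: measurable_funP.
  - exact: measurable_id.
  - exact: lawS.
  - exact: (measurableT_comp mF2 (pair1_measurable _)).
  - by move=> x; exact: F20.
apply: etrans step5 (etrans step4 (etrans step3 (etrans step2 _))).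
apply: eq_integral => w _; apply: eq_integral => x _.
set z := zeta w.
pose k v u := F4 (z, x, v, u).
have mk : measurable_fun setT (fun t : R * R => k t.1 t.2).
  apply: (measurableT_comp mF4); apply: measurable_fun_pair; last exact: measurable_snd.
  apply: measurable_fun_pair; last exact: measurable_fst.
  exact: measurable_cst.
(* [perp_op] integrates V inside U, the successive elimination U inside V. *)
apply: etrans (ge0_integral_swap unif unif mk (fun _ _ => F40 _)) _.
apply: eq_integral => u _.
set y := (u `^ beta * z + (1 - u) `^ beta * x)%R.
have mfv : measurable_fun setT (fun v : R => f ((v `^ rho^-1) `^ beta * y)%R).
  apply: (measurableT_comp mf); apply: measurable_funM; last exact: measurable_cst.
  exact: (measurableT_comp (measurable_powR beta) (measurable_powR rho^-1)).
transitivity (\int[unif]_v ((1 - rho)%:E * f ((v `^ rho^-1) `^ beta * y)%R +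
    rho%:E * f y)).
  apply: eq_integral => v _; rewrite /k /F4 /F5/= /perpetuity_map -/beta -/y.
  by rewrite !mul0r !mul1r !addr0 addrCA subrr addr0 powR1 mul1r.
exact: (integral_mix mfv (fun _ => f0 _) (f0 y)).
Qed.

End perpetuity_integral.

(** * Uniqueness for the perpetuity *)

(* Clipping a uniform variable to [0, 1] keeps its law and turns almost sure
   bounds into pointwise ones. *)
Definition clip01 (R : realType) (x : R) : R := Num.max 0 (Num.min x 1).

Section perpetuity_space.
Context {R : realType} (alpha rho : R) (s : probability R R).
Hypotheses (alpha_gt0 : 0 < alpha) (rho01 : 0 < rho < 1).
Local Notation unif := (uniform01 R).
Local Notation clip := (@clip01 R).
Let beta := alpha^-1.

Let beta_gt0 : 0 < beta. Proof. by rewrite invr_gt0. Qed.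

Let clip_itv x : 0 <= clip x <= 1.
Proof. by rewrite /clip01 le_max lexx/= ge_max ler01 ge_min lexx orbT. Qed.

Let measurable_clip : measurable_fun setT clip.
Proof. by apply: measurable_maxr => //; exact: measurable_minr. Qed.

Let clip_law A : measurable A -> unif (clip @^-1` A) = unif A.
Proof.
move=> mA.
have mcA : measurable (clip @^-1` A) by rewrite -[_ @^-1` _]setTI; exact:
    measurable_clip.
have E (D : set R) : measurable D -> (unif D = \int[unif]_u (\1_D u)%:E)%E.
  by move=> mD; rewrite integral_indic// setIT.
have mI (D : set R) : measurable D -> measurable_fun setT (fun u : R => (\1_D u
    : R)%:E).
  by move=> mD; exact/measurable_EFinP/measurable_indic.
rewrite !E// !integral_uniform01//; [|exact: mI..].
apply: eq_integral => u; rewrite inE/= in_itv/= => /andP[u0 u1].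
have cu : clip u = u by rewrite /clip01 min_l ?max_r// ltW.
by transitivity ((\1_A (clip u) : R)%:E); [rewrite !indicE|rewrite cu].
Qed.

(** A model of (B, U, V, S) as coordinates of a product space; [true] encodes B = 1, of probability
    1 - rho. *)
Let W0 : probability (bool * R)%type R :=
  ((bernoulli_prob (1 - rho) : probability bool R) \x unif)%E.
Let W1 : probability (bool * R * R)%type R := (W0 \x unif)%E.
Let W : probability (bool * R * R * R)%type R := (W1 \x s)%E.

Let b (w : bool * R * R * R) : R := if w.1.1.1 then 1 else 0.
Let u (w : bool * R * R * R) : R := clip w.1.1.2.
Let v (w : bool * R * R * R) : R := clip w.1.2.

Let mb : measurable_fun setT b.
Proof.
apply: measurable_fun_ifT => //.
exact: (measurable_comp_fst _ (measurable_comp_fst _ measurable_fst)).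
Qed.

Let mu : measurable_fun setT u.
Proof.
apply: (measurableT_comp measurable_clip).
exact: (measurable_comp_fst _ (measurable_comp_fst _ measurable_snd)).
Qed.

Let mv : measurable_fun setT v.
Proof.
apply: (measurableT_comp measurable_clip).
exact: (measurable_comp_fst _ measurable_snd).
Qed.

Let W_rect (A0 : set bool) (A1 A2 A3 : set R) :
  measurable A1 -> measurable A2 -> measurable A3 ->
  W (A0 `*` A1 `*` A2 `*` A3) =
  (bernoulli_prob (1 - rho) A0 * unif A1 * unif A2 * s A3)%E.
Proof.
move=> m1 m2 m3.
have m01 : measurable (A0 `*` A1) by exact: measurableX.
have m012 : measurable (A0 `*` A1 `*` A2) by exact: measurableX.
apply: etrans (@product_measure1E _ _ _ _ _ W1 s _ _ m012 m3) _; congr (_ * _)%E.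
apply: etrans (@product_measure1E _ _ _ _ _ W0 unif _ _ m01 m2) _; congr (_ * _)%E.
exact: product_measure1E.
Qed.

Let Lambda w : R := 1 + b w * (v w `^ rho^-1 - 1).

Let coef w : R := Lambda w `^ beta * u w `^ beta.
Let shift w : R := Lambda w `^ beta * ((1 - u w) `^ beta * w.2).

Let mLambda : measurable_fun setT (fun w => Lambda w `^ beta).
Proof.
apply: (measurableT_comp (measurable_powR _)); apply: measurable_funD => //.
apply: measurable_funM => //; apply: measurable_funB => //.
exact: (measurableT_comp (measurable_powR _) mv).
Qed.

Let mcoef : measurable_fun setT coef.
Proof.
apply: measurable_funM => //.
exact: (measurableT_comp (measurable_powR _) mu).
Qed.

Let mshift : measurable_fun setT shift.
Proof.
apply: measurable_funM => //; apply: measurable_funM => //.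
apply: (measurableT_comp (measurable_powR _)); exact: measurable_funB.
Qed.

Let coef_ge0 w : 0 <= coef w.
Proof. by rewrite mulr_ge0 ?powR_ge0. Qed.

Let le1_powR x r : 0 <= r -> 0 <= x <= 1 -> x `^ r <= 1 :> R.
Proof.
move=> r0 /andP[x0 x1]; rewrite -[leRHS](_ : 1 `^ r = 1); last by rewrite powR1.
by apply: ge0_ler_powR => //; rewrite nnegrE.
Qed.

Let Lambda01 w : 0 <= Lambda w <= 1.
Proof.
rewrite /Lambda /b; case: ifP => _; last by rewrite mul0r addr0 lexx ler01.
rewrite mul1r addrCA subrr addr0 powR_ge0/= le1_powR ?clip_itv// invr_ge0 ltW//.
by case/andP : rho01.
Qed.

Let coef_le w : coef w <= u w `^ beta.
Proof.
rewrite ler_piMl ?powR_ge0//; apply: le1_powR (Lambda01 w).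
exact: ltW.
Qed.

(** A cruder contraction factor than E U^beta, which avoids integrating the power: U^beta is at most
    (1/2)^beta for U <= 1/2 and at most 1 otherwise, each with probability 1/2. *)
Let c : R := ((1 / 2) `^ beta + 1) / 2.

Let half_lt1 : (1 / 2) `^ beta < 1 :> R.
Proof.
rewrite -[ltRHS](_ : 1 `^ beta = 1); last by rewrite powR1.
by apply: gt0_ltr_powR; rewrite ?nnegrE//; lra.
Qed.

Let c01 : 0 <= c < 1.
Proof. by have := half_lt1; have := powR_ge0 (1 / 2 : R) beta; rewrite /c; lra. Qed.

Let coef_integral : (\int[W]_w (coef w)%:E <= c%:E)%E.
Proof.
have mp : measurable_fun setT (fun x : R => (clip x `^ beta)%:E).
  by apply/measurable_EFinP; exact: (measurableT_comp (measurable_powR _)).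
have p0 x : (0 <= (clip x `^ beta)%:E)%E by rewrite lee_fin powR_ge0.
(* Since Lambda lies in [0, 1], its power is dropped and only U^beta is kept. *)
apply: (@le_trans _ _ (\int[W]_w (u w `^ beta)%:E)%E).
  apply: ge0_le_integral => //.
  - by move=> w _; rewrite lee_fin.
  - exact/measurable_EFinP.
  - by apply/measurable_EFinP; exact: (measurableT_comp (measurable_powR _) mu).
  - by move=> w _; rewrite lee_fin.
have -> : (\int[W]_w (u w `^ beta)%:E = \int[unif]_x (clip x `^ beta)%:E)%E.
  apply: (@eq_law_integral _ _ _ R R _ _ W unif (fun w => w.1.1.2) idfun
    (fun x => (clip x `^ beta)%:E)) => //.
  - exact: (measurable_comp_fst _ (measurable_comp_fst _ measurable_snd)).
  - exact: measurable_id.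
  move=> A mA.
  rewrite (_ : _ @^-1` A = setT `*` A `*` setT `*` setT).
    apply: etrans (W_rect _ mA measurableT measurableT) _.
    by rewrite !probability_setT mul1e !mule1.
  by apply/seteqP; split => -[[[b' u'] v'] s'] //= -[[[]]].
pose q : R := (1 / 2) `^ beta.
have q0 : 0 <= q by exact: powR_ge0.
have q1 : 0 <= 1 - q by have := half_lt1; rewrite -/q; lra.
pose t (x : R) : \bar R := if 1 / 2 < x then 1%E else 0%E.
have mt : measurable_fun setT t.
  by apply: measurable_fun_ifT => //; exact: measurable_fun_ltr.
have t0 x : (0 <= t x)%E by rewrite /t; case: ifP.
have -> : (c%:E = \int[unif]_x (q%:E + (1 - q)%:E * t x))%E.
  rewrite ge0_integralD//; last 2 first.
  - by move=> x _; rewrite mule_ge0.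
  - exact: measurable_funeM.
  rewrite ge0_integralZl_EFin// uniform_tail//; last by lra.
  by rewrite probability_integral_cst -EFinM -EFinD; congr EFin; rewrite /c -/q; lra.
rewrite !integral_uniform01//; last 2 first.
- by apply: emeasurable_funD => //; exact: measurable_funeM.
- by move=> x; rewrite adde_ge0// mule_ge0.
apply: ge0_le_integral => //.
- exact: measurable_funTS.
- by apply: measurable_funTS; apply: emeasurable_funD => //; exact: measurable_funeM.
move=> x; rewrite /= in_itv/= => /andP[x0 x1].
have -> : clip x = x by rewrite /clip01 min_l ?max_r// ltW.
rewrite /t; case: ltP => x2.
  rewrite mule1 -EFinD addrC subrK lee_fin; apply: le1_powR; first exact: ltW.
  by apply/andP; split; exact: ltW.
rewrite mule0 adde0 lee_fin; apply: ge0_ler_powR => //; first exact: ltW.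
- by rewrite nnegrE ltW.
- by rewrite nnegrE; lra.
Qed.

Let perp_affine w z :
  perpetuity_map alpha rho (b w) (u w) (v w) w.2 z = coef w * z + shift w.
Proof. by rewrite /perpetuity_map -/beta -/(Lambda w) /coef /shift; ring. Qed.

Section with_solution.
Context (m : probability R R).

Let Q : probability (bool * R * R * R * R)%type R := (W \x m)%E.

Let mf_Bq := isMeasurableFun.Build _ _ _ _ _ (measurable_comp_fst R mb).
Let Bq : {RV Q >-> R} := HB.pack (fun z : bool * R * R * R * R => b z.1) mf_Bq.
Let mf_Uq := isMeasurableFun.Build _ _ _ _ _ (measurable_comp_fst R mu).
Let Uq : {RV Q >-> R} := HB.pack (fun z : bool * R * R * R * R => u z.1) mf_Uq.
Let mf_Vq := isMeasurableFun.Build _ _ _ _ _ (measurable_comp_fst R mv).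
Let Vq : {RV Q >-> R} := HB.pack (fun z : bool * R * R * R * R => v z.1) mf_Vq.
Let mf_Sq := isMeasurableFun.Build _ _ _ _ _ (measurable_comp_fst R
    (measurable_snd : measurable_fun setT (snd : bool * R * R * R -> R))).
Let Sq : {RV Q >-> R} := HB.pack (fun z : bool * R * R * R * R => z.1.2) mf_Sq.
Let mf_Zq := isMeasurableFun.Build _ _ _ _ _ (measurable_snd : measurable_fun
    setT (snd : bool * R * R * R * R -> R)).
Let Zq : {RV Q >-> R} := HB.pack (fun z : bool * R * R * R * R => z.2) mf_Zq.

Let Q_rect (A0 : set bool) (A1 A2 A3 A4 : set R) :
  measurable A1 -> measurable A2 -> measurable A3 -> measurable A4 ->
  Q (A0 `*` A1 `*` A2 `*` A3 `*` A4) =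
  (bernoulli_prob (1 - rho) A0 * unif A1 * unif A2 * s A3 * m A4)%E.
Proof.
move=> m1 m2 m3 m4.
have m0 : measurable (A0 `*` A1 `*` A2 `*` A3) by do ! apply: measurableX.
apply: etrans (@product_measure1E _ _ _ _ _ W m _ _ m0 m4) _; congr (_ * _)%E.
exact: W_rect.
Qed.

Let mclip A : measurable A -> measurable (clip @^-1` A).
Proof. by move=> mA; rewrite -[_ @^-1` _]setTI; exact: measurable_clip. Qed.

Let bool_real (x : bool) : R := if x then 1 else 0.

Let law_Bq A : measurable A -> Q (Bq @^-1` A) = bernoulli_prob (1 - rho)
    (bool_real @^-1` A).
Proof.
move=> mA; rewrite (_ : _ @^-1` A = bool_real @^-1` A `*` setT `*` setT `*`
    setT `*` setT).
  apply: etrans (Q_rect _ measurableT measurableT measurableT measurableT) _.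
  by rewrite !probability_setT !mule1.
by apply/seteqP; split => -[[[[b' u'] v'] s'] z'] //= -[[[[]]]].
Qed.

Let law_Uq A : measurable A -> Q (Uq @^-1` A) = unif A.
Proof.
move=> mA; rewrite (_ : _ @^-1` A = setT `*` (clip @^-1` A) `*` setT `*` setT `*` setT).
  apply: etrans (Q_rect _ (mclip mA) measurableT measurableT measurableT) _.
  by rewrite !probability_setT mul1e !mule1 clip_law.
by apply/seteqP; split => -[[[[b' u'] v'] s'] z'] //= -[[[[]]]].
Qed.

Let law_Vq A : measurable A -> Q (Vq @^-1` A) = unif A.
Proof.
move=> mA; rewrite (_ : _ @^-1` A = setT `*` setT `*` (clip @^-1` A) `*` setT `*` setT).
  apply: etrans (Q_rect _ measurableT (mclip mA) measurableT measurableT) _.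
  by rewrite !probability_setT !mule1 !mul1e clip_law.
by apply/seteqP; split => -[[[[b' u'] v'] s'] z'] //= -[[[[]]]].
Qed.

Let law_Sq A : measurable A -> Q (Sq @^-1` A) = s A.
Proof.
move=> mA; rewrite (_ : _ @^-1` A = setT `*` setT `*` setT `*` A `*` setT).
  apply: etrans (Q_rect _ measurableT measurableT mA measurableT) _.
  by rewrite !probability_setT !mule1 mul1e.
by apply/seteqP; split => -[[[[b' u'] v'] s'] z'] //= -[[[[]]]].
Qed.

Let law_Zq A : measurable A -> Q (Zq @^-1` A) = m A.
Proof.
move=> mA; rewrite (_ : _ @^-1` A = setT `*` setT `*` setT `*` setT `*` A).
  apply: etrans (Q_rect _ measurableT measurableT measurableT mA) _.
  by rewrite !probability_setT !mule1 mul1e.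
by apply/seteqP; split => -[[[[b' u'] v'] s'] z'] //= -[[[[]]]].
Qed.

Let indep_Q : independent Q
  (tnth [tuple (Bq : _ -> R); (Uq : _ -> R); (Vq : _ -> R); (Sq : _ -> R); (Zq
      : _ -> R)]).
Proof.
move=> A mA.
set tup := [tuple _; _; _; _; _].
pose o k (k5 : (k < 5)%N) : 'I_5 := Ordinal k5.
have T0 : tnth tup (@o 0%N isT) = (Bq : _ -> R) by rewrite (tnth_nth (Bq : _ -> R)).
have T1 : tnth tup (@o 1%N isT) = (Uq : _ -> R) by rewrite (tnth_nth (Bq : _ -> R)).
have T2 : tnth tup (@o 2%N isT) = (Vq : _ -> R) by rewrite (tnth_nth (Bq : _ -> R)).
have T3 : tnth tup (@o 3%N isT) = (Sq : _ -> R) by rewrite (tnth_nth (Bq : _ -> R)).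
have T4 : tnth tup (@o 4%N isT) = (Zq : _ -> R) by rewrite (tnth_nth (Bq : _ -> R)).
rewrite (_ : \bigcap_(i in _) _ = (bool_real @^-1` A (@o 0%N isT)) `*`
  (clip @^-1` A (@o 1%N isT)) `*` (clip @^-1` A (@o 2%N isT)) `*`
  (A (@o 3%N isT)) `*` (A (@o 4%N isT))); last first.
  apply/seteqP; split => -[[[[b' u'] v'] s'] z'] /= h.
    have := h (@o 0%N isT) I; have := h (@o 1%N isT) I; have := h (@o 2%N isT) I.
    have := h (@o 3%N isT) I; have := h (@o 4%N isT) I.
    by rewrite T0 T1 T2 T3 T4.
  case: h => -[[[h0 h1] h2] h3] h4 i _.
  case: i => -[|[|[|[|[|//]]]]] i5.
  - by rewrite (_ : Ordinal i5 = @o 0%N isT) ?T0//; exact: val_inj.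
  - by rewrite (_ : Ordinal i5 = @o 1%N isT) ?T1//; exact: val_inj.
  - by rewrite (_ : Ordinal i5 = @o 2%N isT) ?T2//; exact: val_inj.
  - by rewrite (_ : Ordinal i5 = @o 3%N isT) ?T3//; exact: val_inj.
  - by rewrite (_ : Ordinal i5 = @o 4%N isT) ?T4//; exact: val_inj.
apply: etrans (Q_rect _ (mclip (mA _)) (mclip (mA _)) (mA _) (mA _)) _.
rewrite !clip_law//.
transitivity (\prod_(i <- [:: @o 0%N isT; @o 1%N isT; @o 2%N isT; @o 3%N isT;
    @o 4%N isT])
   Q (tnth tup i @^-1` A i))%E.
  rewrite !big_cons big_nil T0 T1 T2 T3 T4 mule1 !muleA.
  by rewrite law_Bq// law_Uq// law_Vq// law_Sq// law_Zq.
apply: perm_big; apply: uniq_perm => //; first exact: index_enum_uniq.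
by case=> -[|[|[|[|[|//]]]]] i5; rewrite mem_index_enum.
Qed.

Let bernoulli_Bq (x : bool) : Q [set z | Bq z = bool_real x] =
  bernoulli_prob (1 - rho) [set x].
Proof.
apply: etrans (law_Bq (measurable_set1 _)) _; congr bernoulli_prob.
apply/seteqP; split => y /=; last by move=> ->.
by rewrite /bool_real; case: x; case: y => // /eqP; rewrite ?oner_eq0// eq_sym oner_eq0.
Qed.

Let p01 : 0 <= 1 - rho <= 1.
Proof. by case/andP : rho01 => r0 r1; apply/andP; split; lra. Qed.

Let mperp : measurable_fun setT (fun z : bool * R * R * R * R => coef z.1 * z.2
    + shift z.1).
Proof.
apply: measurable_funD; last exact: measurable_comp_fst.
apply: measurable_funM; last exact: measurable_snd.
exact: measurable_comp_fst.
Qed.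

(** The definition of a solution is instantiated at the product [Q] of the model with [m], where
    [zeta] is the last coordinate; Tonelli turns equality in law into a fixed-point equation for
    [m]. *)
Lemma solution_affine_fixpoint (sigma : set R -> \bar R) :
  (forall A, measurable A -> s A = sigma A) ->
  solves_perpetuity alpha rho sigma m ->
  forall f, measurable_fun setT f -> (forall x, 0 <= f x)%E ->
  (\int[m]_x f x = \int[m]_x \int[W]_w f (coef w * x + shift w)%R)%E.
Proof.
move=> sE msol f mf f0.
have QB1 : Q [set z | Bq z = 1] = (1 - rho)%:E.
  apply: etrans (bernoulli_Bq true) _; rewrite bernoulli_probE// !diracE.
  by rewrite mem_set// memNset//= mule0 adde0 mule1.
have QB0 : Q [set z | Bq z = 0] = rho%:E.
  apply: etrans (bernoulli_Bq false) _; rewrite bernoulli_probE// !diracE.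
  by rewrite memNset//= mem_set//= mule0 add0e mule1; congr EFin; exact: subKr.
have lawS : eq_law (pushforward Q Sq) sigma.
  by move=> A mA; rewrite -sE//; exact: law_Sq.
have := msol _ _ Q Bq Uq Vq Sq Zq indep_Q QB1 QB0 law_Uq law_Vq lawS law_Zq.
move=> perpE.
have -> : (\int[m]_x f x = \int[Q]_z f (Zq z))%E.
  apply: (@eq_law_integral _ _ _ R R _ _ m Q idfun Zq f) => //.
  - exact: measurable_id.
  - by move=> A mA; exact: esym (law_Zq mA).
have -> : (\int[Q]_z f (Zq z) = \int[Q]_z f (coef z.1 * z.2 + shift z.1)%R)%E.
  apply: (@eq_law_integral _ _ _ R R _ _ Q Q Zq
    (fun z => coef z.1 * z.2 + shift z.1) f) => //.
  move=> A mA; apply: etrans (perpE A mA) _; congr (Q _).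
  by apply/seteqP; split => z; rewrite /preimage/= perp_affine.
exact: (@fubini_tonelli2 _ _ _ _ _ W m _ (measurableT_comp mf mperp) (fun z => f0 _)).
Qed.

End with_solution.

Lemma perpetuity_unique (sigma : set R -> \bar R) (m1 m2 : probability R R) :
  (forall A, measurable A -> s A = sigma A) ->
  solves_perpetuity alpha rho sigma m1 -> solves_perpetuity alpha rho sigma m2 ->
  eq_law m1 m2.
Proof.
move=> sE sol1 sol2.
exact: (affine_fixpoint_unique mcoef mshift coef_ge0 coef_integral c01
  (solution_affine_fixpoint sE sol1) (solution_affine_fixpoint sE sol2)).
Qed.

End perpetuity_space.

Theorem theorem1 (R : realType) (d : measure_display) (T : measurableType d)
    (P : probability T R) (alpha rho : R) (Y : R -> {RV P >-> R})
    (alpha_range : 0 < alpha <= 2) (rho_range : 0 < rho < 1)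
    (Y_stable : stable_process alpha rho Y) :
  let sigma := cond_law P (Y 1) [set w | 0 < Y 1 w] in
  let law_sup := pushforward P (sup01 Y) in
  solves_perpetuity alpha rho sigma law_sup /\
  forall mu : probability R R,
    solves_perpetuity alpha rho sigma mu -> eq_law mu law_sup.
Proof.
move=> sigma law_sup.
have [s sE] := cond_law_probability rho_range (stable_positivity Y_stable).
have alpha0 : 0 < alpha by case/andP : alpha_range.
have mS := measurable_sup01 Y_stable.
have pS := isMeasurableFun.Build _ _ _ _ _ mS.
pose S' : {mfun T >-> R} := HB.pack (sup01 Y) pS.
have sup_solves : solves_perpetuity alpha rho sigma law_sup.
  move=> d' T' Q B U V S zeta indepX QB1 QB0 lawU lawV lawS lawZ.
  have mperp : measurable_fun setT (fun w => perpetuity_map alpha rho (B w) (U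
      w) (V w) (S w) (zeta w)).
    apply: measurable_funM.
      apply: (measurableT_comp (measurable_powR _)); apply: measurable_funD => //.
      apply: measurable_funM => //; apply: measurable_funB => //.
      exact: (measurableT_comp (measurable_powR _) (measurable_funP V)).
    apply: measurable_funD; apply: measurable_funM => //.
      exact: (measurableT_comp (measurable_powR _) (measurable_funP U)).
    by apply: (measurableT_comp (measurable_powR _)); exact: measurable_funB.
  have pp := isMeasurableFun.Build _ _ _ _ _ mperp.
  pose X' : {mfun T' >-> R} := HB.pack (fun w => perpetuity_map alpha rho (B w)
      (U w) (V w) (S w) (zeta w)) pp.
  (* Test functions with values in [0, 1] are enough to compare the laws, as required by
     [sup01_fixed]. *)
  apply: (@lipschitz_law_ext R (distribution Q zeta) (distribution Q X')).
  - by rewrite (le_lt_trans (probability_le1 _ _)) ?ltry.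
  - by rewrite (le_lt_trans (probability_le1 _ _)) ?ltry.
  move=> L f fL f01.
  have mf : measurable_fun setT (EFin \o f).
    apply/measurable_EFinP; apply: continuous_measurable_fun.
    exact: lipschitz_le_continuous fL.
  have Ef01 x : (0 <= (EFin \o f) x <= 1)%E by rewrite /= !lee_fin.
  have f0 x : (0 <= (EFin \o f) x)%E by case/andP : (Ef01 x).
  apply: etrans (ge0_integral_distribution zeta mf f0) _.
  apply: etrans _ (esym (ge0_integral_distribution X' mf f0)).
  have lawS' : eq_law (pushforward Q S) s by move=> A mA; rewrite sE//; exact: lawS.
  transitivity (\int[Q]_w perp_op alpha rho s (EFin \o f) (zeta w))%E; last first.
    exact: esym (perp_integral alpha rho_range indepX QB1 QB0 lawU lawV lawS' mf f0).
  have zsup (g : R -> \bar R) : measurable_fun setT g -> (forall x, 0 <= g x)%E ->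
      (\int[Q]_w g (zeta w) = \int[P]_w g (sup01 Y w))%E.
    by move=> mg g0; apply: eq_law_integral.
  apply: etrans (zsup _ mf f0) _.
  apply: etrans (sup01_fixed rho_range Y_stable sE mf Ef01) _.
  have [K0 C0] : (forall x, 0 <= perp_powscale alpha^-1 rho (EFin \o f) x)%E /\
      (forall x, 0 <= rho%:E * (EFin \o f) x +
        (1 - rho)%:E * perp_powscale alpha^-1 rho (EFin \o f) x)%E.
    have K0 x : (0 <= perp_powscale alpha^-1 rho (EFin \o f) x)%E.
      by apply: integral_ge0 => v _; exact: f0.
    split=> // x; case/andP : rho_range => r0 r1.
    by rewrite adde_ge0// mule_ge0// lee_fin ?subr_ge0 ltW.
  apply: esym; apply: zsup.
    apply: measurable_perp_add => //.
    apply: emeasurable_funD; apply: measurable_funeM => //.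
    exact: measurable_perp_powscale.
  by move=> x; apply: integral_ge0 => y _; apply: integral_ge0 => u _; exact: C0.
split=> // mu mu_solves.
(* Uniqueness compares two solutions, the second being the law of the supremum; [distribution P S']
   is [law_sup] packaged as a probability. *)
exact: (perpetuity_unique alpha0 rho_range sE mu_solves (sup_solves :
    solves_perpetuity alpha rho sigma (distribution P S'))).
Qed.
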